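(* $\lim_{N\to\infty}\delta_{K_N}=\infty$, where $N$ ranges over the positive integers and $\delta_{K_N}$ is the reduction discrepancy of the cyclotomic field $K_N=\mathbb{Q}(\zeta_N)$.
   Context: For a positive integer $N$, $\zeta_N=\exp(2\pi i/N)$ and $K_N=\mathbb{Q}(\zeta_N)$. For $K=K_N$, $\mathcal{O}_K$ is the ring of integers, $\mathcal{O}_K^*$ the unit group, and $*$ denotes complex conjugation (the identity if $K=\mathbb{Q}$). An element $a\in K$ is totally positive if $\sigma(a)\in\mathbb{R}_{>0}$ for every embedding $\sigma:K\to\mathbb{C}$; $K_{>>0}$ is the set of totally positive elements. For $a\in K_{>>0}$ define $\mu(a)=\min_{x\in\mathcal{O}_K\setminus\{0\}}\mathrm{Tr}_{K/\mathbb{Q}}(axx^* )$ and $\mu^*(a)=\min_{u\in\mathcal{O}_K^*}\mathrm{Tr}_{K/\mathbb{Q}}(auu^* )$. The reduction discrepancy of $K$ is $\delta_K=\sup_{a\in K_{>>0}}\mu^*(a)/\mu(a)$. *)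

(* Defs.v *)
From HB Require Import structures.
From mathcomp Require Import all_boot all_order all_algebra all_field.
From mathcomp Require Import complex ring lra.
From mathcomp Require Import all_classical all_reals all_analysis.

Set Implicit Arguments.
Unset Strict Implicit.
Unset Printing Implicit Defensive.

Import Order.TTheory GRing.Theory Num.Theory.
Import numFieldNormedType.Exports.

Local Open Scope classical_set_scope.
Local Open Scope ring_scope.

Section NumberField.

Variable K : fieldExtType rat.

(* The trace of the Q-linear map x |-> a * x, in a basis of K. *)
Definition field_trace (a : K) : rat :=
  let e := vbasis {:K} in
  \tr (\matrix_(i < \dim {:K}, j < \dim {:K}) coord e j (a * e`_i)).

Definition ring_of_integers : set K :=
  [set x | integralOver (intr : int -> K) x].

Definition unit_group : set K :=
  [set u | ring_of_integers u /\ exists2 v, ring_of_integers v & u * v = 1].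

(* In R[i], 0 < z holds if and only if z is real and positive. *)
Definition totally_positive (R : realType) : set K :=
  [set a | forall s : {rmorphism K -> R[i]}, 0 < s a].

End NumberField.

(* star is the complex conjugation of K. *)
Section ReductionDiscrepancy.

Variables (R : realType) (K : fieldExtType rat) (star : K -> K).

Definition trace_form (a x : K) : R := ratr (field_trace (a * x * star x)).

(* For a totally positive, the traces below are nonnegative rational numbers
   with bounded denominators, so that both infima are minima. *)
Definition mu (a : K) : R :=
  inf [set trace_form a x | x in @ring_of_integers K `\ 0].

Definition mu_units (a : K) : R :=
  inf [set trace_form a u | u in @unit_group K].

Definition reduction_discrepancy : \bar R :=
  ereal_sup [set (mu_units a / mu a)%:E | a in @totally_positive K R].

End ReductionDiscrepancy.

Section Cyclotomic.

Variable R : realType.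

(* exp(2 pi i / N); the junk value at N = 0 is 1. *)
Definition zeta (N : nat) : R[i] :=
  (cos (2 * pi / N%:R) +i* sin (2 * pi / N%:R))%C.

Lemma zetaX (N k : nat) :
  zeta N ^+ k =
  (cos (2 * pi / N%:R * k%:R) +i* sin (2 * pi / N%:R * k%:R))%C.
Proof.
elim: k => [|k IHk]; first by rewrite !mulr0 cos0 sin0.
rewrite exprSr IHk -(natr1 k) [_ * (k%:R + 1)]mulrDr mulr1 cosD sinD /zeta.
by apply/eqP; rewrite eq_complex /= [X in _ && (_ == X)]addrC !eqxx.
Qed.

Lemma zeta0 : zeta 0 = 1.
Proof. by rewrite /zeta invr0 mulr0 cos0 sin0. Qed.

Lemma zeta_prim (N : nat) : (0 < N)%N -> N.-primitive_root (zeta N).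
Proof.
move=> N_gt0; have N0 : N%:R != 0 :> R by rewrite pnatr_eq0 -lt0n.
have zN1 : zeta N ^+ N = 1.
  by rewrite zetaX divfK // mulrC mulr_natr cos2pi sin2pi.
have [m m_prim m_dvd] := prim_order_exists N_gt0 zN1.
suff Nm : N = m by rewrite {1}Nm.
have m_gt0 := prim_order_gt0 m_prim.
apply/eqP; rewrite eqn_leq (dvdn_leq N_gt0 m_dvd) andbT leqNgt.
apply/negP => ltmN; pose t : R := pi / N%:R * m%:R.
have t_gt0 : 0 < t by rewrite mulr_gt0 ?divr_gt0 ?pi_gt0 ?ltr0n.
have t_ltpi : t < pi.
  by rewrite /t mulrAC ltr_pdivrMr ?ltr0n // ltr_pM2l ?pi_gt0 // ltr_nat.
have: zeta N ^+ m = 1 by rewrite (prim_expr_order m_prim).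
rewrite zetaX => -[+ _].
have -> : 2 * pi / N%:R * m%:R = t *+ 2 by rewrite /t; ring.
rewrite cos_mulr2n cos2sin2 => cos1.
have /eqP : sin t ^+ 2 = 0 by move: cos1 => /=; lra.
rewrite expf_eq0 /= => /eqP sin0t.
by have := @sin_gt0_pi R t; rewrite sin0t t_gt0 t_ltpi ltxx => /(_ isT).
Qed.

Lemma zeta_conj (N : nat) : (zeta N)^*%C = (zeta N)^-1.
Proof.
have zz : zeta N * (zeta N)^*%C = 1.
  rewrite /zeta; apply/eqP; rewrite eq_complex /=.
  by rewrite mulrN opprK -!expr2 cos2Dsin2 mulrN mulrC addNr !eqxx.
have z0 : zeta N != 0.
  by apply/eqP => z0; move/eqP: zz; rewrite z0 mul0r eq_sym oner_eq0.
by apply: (mulfI z0); rewrite zz divff.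
Qed.

(* 'Phi_0 = 1 is not irreducible, hence the truncation at 1; the field of
   index 0 is then Q, which is consistent with zeta 0 = 1. *)
Definition cyclotomic_poly (N : nat) : {poly rat} :=
  map_poly intr 'Phi_(maxn 1 N).

Lemma cyclotomic_poly_irr (N : nat) : irreducible_poly (cyclotomic_poly N).
Proof.
rewrite /cyclotomic_poly; set n := maxn 1 N.
have n_gt0 : (0 < n)%N by rewrite leq_maxl.
have [w w_prim] := C_prim_root_exists n_gt0.
have [p [Dp p_mon] p_min] := minCpolyP w.
have -> : map_poly intr 'Phi_n = p.
  apply: (@map_poly_inj _ algC ratr).
  rewrite -Dp (minCpoly_cyclotomic w_prim) -(Cintr_Cyclotomic w_prim).
  by rewrite -map_poly_comp; apply: eq_map_poly => c; rewrite /= ratr_int.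
have p_root : root (map_poly (ratr : {rmorphism rat -> algC}) p) w.
  by rewrite p_min.
apply/(subfx_irreducibleP p_root (monic_neq0 p_mon)) => q.
by rewrite p_min => pq q0; apply: dvdp_leq.
Qed.

Lemma cyclotomic_poly_root (N : nat) :
  root (map_poly (ratr : {rmorphism rat -> R[i]}) (cyclotomic_poly N)) (zeta N).
Proof.
rewrite /cyclotomic_poly; set n := maxn 1 N.
have n_gt0 : (0 < n)%N by rewrite leq_maxl.
have z_prim : n.-primitive_root (zeta N).
  rewrite {}/n in n_gt0 *; case: N n_gt0 => [|N] n_gt0.
    apply/andP; split=> //; apply/forallP => j.
    by rewrite ord1 unity_rootE zeta0 expr1 !eqxx.
  by rewrite (maxn_idPr _) ?zeta_prim.
have PhiE d : map_poly (ratr : rat -> R[i]) (map_poly intr 'Phi_d)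
            = map_poly intr 'Phi_d.
  by rewrite -map_poly_comp; apply: eq_map_poly => c; rewrite /= ratr_int.
have prodE d : (0 < d)%N ->
    \prod_(e <- divisors d) map_poly intr 'Phi_e = 'X^d - 1 :> {poly R[i]}.
  move=> d_gt0; rewrite -rmorph_prod prod_Cyclotomic //=.
  by rewrite rmorphB rmorph1 /= map_polyXn.
rewrite PhiE.
have : root ('X^n - 1) (zeta N).
  by rewrite -/(root_of_unity _ _) unity_rootE (prim_expr_order z_prim).
rewrite -prodE // rootE horner_prod prodf_seq_eq0 => /hasP[d].
rewrite -dvdn_divisors // => d_dvd /= d_root.
have d_gt0 := dvdn_gt0 n_gt0 d_dvd.
suff -> : n = d by [].
apply/eqP; rewrite eqn_dvd d_dvd andbT (prim_order_dvd z_prim) -unity_rootE.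
rewrite /root_of_unity -prodE // rootE horner_prod prodf_seq_eq0.
apply/hasP; exists d => //.
by rewrite -dvdn_divisors.
Qed.

Definition cyclotomic_field (N : nat) : fieldExtType rat :=
  SubFieldExtType (cyclotomic_poly_root N) (cyclotomic_poly_irr N).

Definition cyclotomic_incl (N : nat) : {rmorphism cyclotomic_field N -> R[i]} :=
  @subfx_inj _ _ (ratr : {rmorphism rat -> R[i]}) (zeta N) (cyclotomic_poly N).

Definition cyclotomic_gen (N : nat) : cyclotomic_field N :=
  subfx_root (ratr : {rmorphism rat -> R[i]}) (zeta N) (cyclotomic_poly N).

Lemma cyclotomic_incl_gen (N : nat) :
  cyclotomic_incl N (cyclotomic_gen N) = zeta N.
Proof.
apply: subfx_inj_root; first exact: cyclotomic_poly_root.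
exact: irredp_neq0 (cyclotomic_poly_irr N).
Qed.

Lemma cyclotomic_field_horner (N : nat) (x : cyclotomic_field N) :
  exists q : {poly rat},
    x = (map_poly (in_alg (cyclotomic_field N)) q).[cyclotomic_gen N].
Proof.
have [q ->] := subfxEroot (cyclotomic_poly_root N)
  (irredp_neq0 (cyclotomic_poly_irr N)) x.
by exists q.
Qed.

Lemma cyclotomic_fieldE (N : nat) : <<1; cyclotomic_gen N>>%VS = fullv.
Proof.
apply/vspaceP => x; rewrite memvf; have [q ->] := cyclotomic_field_horner x.
apply/Fadjoin_polyP; exists (map_poly (in_alg (cyclotomic_field N)) q) => //.
by apply/polyOverP => i; rewrite coef_map memvZ ?mem1v.
Qed.

Lemma cyclotomic_conj_exists (N : nat) (x : cyclotomic_field N) :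
  exists y, cyclotomic_incl N y == (cyclotomic_incl N x)^*%C.
Proof.
have [q ->] := cyclotomic_field_horner x.
exists (map_poly (in_alg (cyclotomic_field N)) q).[(cyclotomic_gen N)^-1].
have inclE y : cyclotomic_incl N
    (map_poly (in_alg (cyclotomic_field N)) q).[y] =
    (map_poly ratr q).[cyclotomic_incl N y].
  rewrite -horner_map -map_poly_comp; congr _.[_]; apply: eq_map_poly => c.
  exact: (subfx_inj_base (cyclotomic_poly_root N)
            (irredp_neq0 (cyclotomic_poly_irr N))).
rewrite !inclE fmorphV cyclotomic_incl_gen -zeta_conj -horner_map.
rewrite -map_poly_comp; apply/eqP; congr _.[_]; apply: eq_map_poly => c /=.
by rewrite fmorph_rat.
Qed.

Definition cyclotomic_conj (N : nat) (x : cyclotomic_field N) :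
  cyclotomic_field N := xchoose (cyclotomic_conj_exists x).

Lemma cyclotomic_conjE (N : nat) (x : cyclotomic_field N) :
  cyclotomic_incl N (cyclotomic_conj x) = (cyclotomic_incl N x)^*%C.
Proof. exact/eqP/(xchooseP (cyclotomic_conj_exists x)). Qed.

Definition delta_cyclotomic (N : nat) : \bar R :=
  reduction_discrepancy R (@cyclotomic_conj N).

End Cyclotomic.

(* Main.v *)
Require Import Defs.
From HB Require Import structures.
From mathcomp Require Import all_boot all_order all_algebra all_field.
From mathcomp Require Import complex ring lra zify.
From mathcomp Require Import all_classical all_reals all_analysis.

Set Implicit Arguments.
Unset Strict Implicit.
Unset Printing Implicit Defensive.

Import Order.TTheory GRing.Theory Num.Theory.

Local Open Scope ring_scope.

(* Write n = M N with M = p^(e+1) the exact power of a prime p dividing n, let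
   zeta = zeta_M, pi = 1 - zeta, omega = zeta^(M/p), d = [K_n : Q], and take
   a = 1/(pi pi^* ). As Tr(a pi pi^* ) = d, it suffices that
   Tr(a u u^* ) >= M d / 98 for every unit u, since large integers n have a
   large prime power component M.
   Put w = u/pi and let G be the Galois group of K_n over K_N. By Parseval,
   Tr(w w^* ) is at least the sum over i mod M of Tr(tau_i tau_i^* ), where
   tau_i = Tr_G(w zeta^-i) / M. As Tr_G(y (1 - omega)) / M is integral for
   integral y, along each class mod M/p the tau_i form an arithmetic progression
   modulo integers, with a common difference b. Here b is not integral, as
   otherwise w, hence 1/pi, would be. Nonzero integers x have Tr(x x^* ) >= d by
   AM-GM, which forces at least half of the p terms of such a progression to be
   long. *)

(** * Roots of unity, rational integrality and indexed sums *)

Lemma sum_expr_unity (F : fieldType) (y : F) (n : nat) :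
  y ^+ n = 1 -> \sum_(k < n) y ^+ k = if y == 1 then n%:R else 0.
Proof.
move=> yn1; case: eqP => [->|/eqP y1].
  under eq_bigr => k _ do rewrite expr1n.
  by rewrite sumr_const card_ord.
apply: (mulfI (_ : y - 1 != 0)); first by rewrite subr_eq0.
by rewrite -subrX1 yn1 subrr mulr0.
Qed.

Lemma map_poly_intr (F G : nzRingType) (f : {rmorphism F -> G}) (p : {poly int}) :
  map_poly f (map_poly intr p) = map_poly intr p.
Proof. by rewrite -map_poly_comp; apply: eq_map_poly => k /=; rewrite rmorph_int. Qed.

(** The monic integer polynomial killing [c] in [K] already kills it in Q, so the image of [c] in
    [algC] is a rational algebraic integer, hence an integer. *)
Lemma integral_rat (K : fieldExtType rat) (c : rat) :
  integralOver (intr : int -> K) c%:A -> c \is a Num.int.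
Proof.
case=> p p_mon p_root.
have p_root_rat : root (map_poly intr p) c.
  by rewrite -(fmorph_root (in_alg K)) map_poly_intr.
have /(Cint_rat_Aint (Crat_rat c)) : (ratr c : algC) \in Aint.
  apply: (@root_monic_Aint (map_poly intr p)).
  - by rewrite -(map_poly_intr ratr) fmorph_root.
  - by apply: (monic_map intr).
  - by apply/polyOverP => i; rewrite coef_map /= intr_int.
case/intrP => m cm; rewrite -[m%:~R](rmorph_int (ratr : {rmorphism rat -> algC})) in cm.
by rewrite (fmorph_inj (ratr : {rmorphism rat -> algC}) cm) intr_int.
Qed.

Section AutSums.

Variables (K : fieldType) (I : finType) (s : I -> {rmorphism K -> K}) (i0 : I).
Hypothesis s_i0 : s i0 =1 id.
Variables (y : K) (n : nat).
Hypotheses (n_gt0 : (0 < n)%N) (yn1 : y ^+ n = 1).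
Hypothesis s_y : forall i, (s i y == y) = (i == i0).

Let y_neq0 : y != 0.
Proof. by apply/eqP => y0; move/eqP: yn1; rewrite y0 expr0n gtn_eqF // eq_sym oner_eq0. Qed.

(** After exchanging the sums, the inner one is geometric in [y / s i y] and vanishes unless [s i]
    fixes [y], that is, unless [i] is [i0]. This finite Fourier inversion serves for the full Galois
    group and for its two factors. *)
Lemma aut_sum_inversion (v : K) :
  \sum_(k < n) (\sum_i s i (v * y ^- k)) * y ^+ k = n%:R * v.
Proof.
under eq_bigr => k _ do rewrite mulr_suml.
rewrite exchange_big (bigD1 i0) //= [X in _ + X]big1 ?addr0.
  under eq_bigr => k _ do [rewrite (s_i0 _) /= divfK ?expf_neq0 //].
  by rewrite sumr_const card_ord mulr_natl.
move=> i ii0; transitivity (s i v * \sum_(k < n) (y / s i y) ^+ k).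
  rewrite mulr_sumr; apply: eq_bigr => k _.
  by rewrite rmorphM fmorphV rmorphXn exprMn exprVn -mulrA [_ ^- _ * _]mulrC.
have siy : s i y != 0 by rewrite fmorph_eq0.
rewrite sum_expr_unity; last by rewrite exprMn exprVn -rmorphXn yn1 rmorph1 divr1.
rewrite [_ == 1](_ : _ = false) ?mulr0 //.
by rewrite -(inj_eq (mulIf siy)) divfK // mul1r eq_sym s_y (negbTE ii0).
Qed.

End AutSums.

Lemma fieldExt_natr_eq0 (K : fieldExtType rat) (n : nat) : (n%:R == 0 :> K) = (n == 0)%N.
Proof. by rewrite -(rmorph_nat (in_alg K)) fmorph_eq0 pnatr_eq0. Qed.

Lemma big_ord_mul (T : Type) (idx : T) (op : Monoid.law idx) (a b : nat) (F : nat -> T) :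
  \big[op/idx]_(i < a * b) F i = \big[op/idx]_(k < a) \big[op/idx]_(r < b) F (k * b + r)%N.
Proof.
elim: a => [|a IHa]; first by rewrite !big_ord0.
by rewrite mulSnr big_split_ord /= IHa big_ord_recr.
Qed.

Lemma big_ord_multiples (T : Type) (idx : T) (op : Monoid.law idx) (a p : nat)
    (F : nat -> T) :
  (0 < p)%N -> \big[op/idx]_(i < a * p | (p %| i)%N) F i = \big[op/idx]_(k < a) F (k * p)%N.
Proof.
case: p => // p _; rewrite big_mkcond.
rewrite (big_ord_mul _ _ _ (fun i => if (p.+1 %| i)%N then F i else idx)).
apply: eq_bigr => k _; rewrite big_ord_recl /= addn0 dvdn_mull // big1 ?Monoid.mulm1 // => r _.
by rewrite dvdn_addr ?dvdn_mull // gtnNdvd //= /bump leq0n add1n ltnS.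
Qed.

(** Since X^n - 1 is the product of the Phi_d over d dividing n, [y] is a root of some Phi_d; then
    y^d = 1, and primitivity forces d = n. *)
Lemma root_Cyclotomic (F : fieldType) (n : nat) (y : F) :
  n.-primitive_root y -> root (map_poly intr 'Phi_n) y.
Proof.
move=> y_prim; have n_gt0 := prim_order_gt0 y_prim.
have prodE d : (0 < d)%N ->
    \prod_(e <- divisors d) map_poly intr 'Phi_e = 'X^d - 1 :> {poly F}.
  move=> d_gt0; rewrite -rmorph_prod prod_Cyclotomic //=.
  by rewrite rmorphB rmorph1 /= map_polyXn.
have : root ('X^n - 1) y.
  by rewrite -/(root_of_unity _ _) unity_rootE (prim_expr_order y_prim).
rewrite -prodE // rootE horner_prod prodf_seq_eq0 => /hasP[d].
rewrite -dvdn_divisors // => d_dvd /= d_root.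
have d_gt0 := dvdn_gt0 n_gt0 d_dvd.
suff -> : n = d by [].
apply/eqP; rewrite eqn_dvd d_dvd andbT (prim_order_dvd y_prim) -unity_rootE.
rewrite /root_of_unity -prodE // rootE horner_prod prodf_seq_eq0.
by apply/hasP; exists d; rewrite // -dvdn_divisors.
Qed.

(** This abstracts from the presentation of the field, so that any primitive root, such as
    [zeta * xi] below, can serve as generator. The boolean equality allows [xchoose] to pick a
    polynomial. *)
Definition cyclotomic_generator (K : fieldExtType rat) (n : nat) (z : K) :=
  [/\ n.-primitive_root z, irreducible_poly (map_poly intr 'Phi_n : {poly rat})
    & forall x : K, exists q, x == (map_poly (in_alg K) q).[z]].

(** * Automorphisms obtained by moving a primitive root *)

Section Rotation.

Variables (K : fieldExtType rat) (n : nat) (z : K).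
Hypothesis z_gen : cyclotomic_generator n z.

Let z_prim : n.-primitive_root z. Proof. by case: z_gen. Qed.
Let gen (x : K) : exists q, x == (map_poly (in_alg K) q).[z].
Proof. by case: z_gen. Qed.

Local Notation "q ^K" := (map_poly (in_alg K) q) (at level 2, format "q ^K").

Let Phi : {poly rat} := map_poly intr 'Phi_n.

(** If Phi did not divide [q], irreducibility would give a Bezout relation, which evaluates to 0 = 1
    at [z]. This makes substitution of [y] for [z] well defined. *)
Lemma conjugate_root (q : {poly rat}) (y : K) :
  n.-primitive_root y -> root q^K z -> root q^K y.
Proof.
move=> y_prim qz.
have Phi_root w : n.-primitive_root w -> root Phi^K w.
  by move=> w_prim; rewrite map_poly_intr root_Cyclotomic.
have [_ irr _] := z_gen.
have: Phi %| q.
  apply: contraLR (oner_neq0 K) => nPq.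
  have: coprimep Phi q by rewrite irreducible_poly_coprime.
  case/Bezout_eq1_coprimepP => -[u v] /= uv1; rewrite negbK.
  move/(congr1 (fun p => p^K.[z])): uv1.
  rewrite rmorph1 hornerC rmorphD !rmorphM hornerD !hornerM.
  by rewrite (rootP qz) (rootP (Phi_root z z_prim)) !mulr0 addr0 => <-.
case/dvdpP=> r ->; rewrite rmorphM rootM (Phi_root y) ?orbT //.
Qed.

Definition poly_of (x : K) : {poly rat} := xchoose (gen x).

Lemma poly_ofP (x : K) : x = (poly_of x)^K.[z].
Proof. exact/eqP/(xchooseP (gen x)). Qed.

Variables (y : K) (y_prim : n.-primitive_root y).

(** The automorphism that sends [z] to [y]. The proof of primitivity is an argument because the
    morphism instances below hold only in its presence. *)
Definition rotation of n.-primitive_root y := fun x : K => (poly_of x)^K.[y].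

Lemma rotation_horner (q : {poly rat}) : rotation y_prim q^K.[z] = q^K.[y].
Proof.
apply/eqP; rewrite /rotation -subr_eq0 -hornerN -hornerD -rmorphB.
apply: (conjugate_root y_prim); rewrite rmorphB /root hornerD hornerN.
by rewrite -poly_ofP subrr.
Qed.

Lemma rotation_zmod : zmod_morphism (rotation y_prim).
Proof.
move=> a b; rewrite {1}(poly_ofP a) {1}(poly_ofP b) -hornerN -hornerD -rmorphB.
by rewrite rotation_horner rmorphB hornerD hornerN.
Qed.

Lemma rotation_monoid : monoid_morphism (rotation y_prim).
Proof.
split; first by have := rotation_horner 1; rewrite rmorph1 -polyC1 !hornerC.
move=> a b; rewrite {1}(poly_ofP a) {1}(poly_ofP b) -hornerM -rmorphM.
by rewrite rotation_horner rmorphM hornerM.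
Qed.

HB.instance Definition _ := GRing.isZmodMorphism.Build K K (rotation y_prim) rotation_zmod.
HB.instance Definition _ := GRing.isMonoidMorphism.Build K K (rotation y_prim) rotation_monoid.

Lemma rotation_gen : rotation y_prim z = y.
Proof.
have := rotation_horner 'X; rewrite map_polyX !hornerX; exact.
Qed.

End Rotation.

Lemma eq_rmorphism_gen (K : fieldExtType rat) (n : nat) (z : K)
    (L : fieldType) (f h : {rmorphism K -> L}) :
  cyclotomic_generator n z -> f z = h z -> f =1 h.
Proof.
case=> _ _ gen fz x; have [q /eqP ->] := gen x.
rewrite -!horner_map -!map_poly_comp fz; congr _.[_]; apply: eq_map_poly => c /=.
exact: etrans (fmorph_eq_rat (f \o in_alg K) c) (esym (fmorph_eq_rat (h \o in_alg K) c)).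
Qed.

(** Write x = q(z) with q reduced modulo Phi. Then q - x has degree less than phi(n) and vanishes at
    the conjugates [s i z], at least phi(n) in number, so it is zero and [x] is the constant
    coefficient of q. *)
Lemma fixed_rational (K : fieldExtType rat) (n : nat) (z : K) (I : finType)
    (s : I -> {rmorphism K -> K}) (x : K) :
  cyclotomic_generator n z -> injective (fun i => s i z) -> (totient n <= #|I|)%N ->
  (forall i, s i x = x) -> exists c, x = c%:A.
Proof.
move=> z_gen s_inj cardI fix_x; have [z_prim irr gen] := z_gen.
pose Phi : {poly rat} := map_poly intr 'Phi_n.
have sPhi : size Phi = (totient n).+1.
  by rewrite size_map_inj_poly ?size_Cyclotomic //; apply: intr_inj.
have [q0 /eqP xq0] := gen x.
pose q := q0 %% Phi.
have xq : x = (map_poly (in_alg K) q).[z].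
  rewrite xq0 {1}(divp_eq q0 Phi) rmorphD rmorphM hornerD hornerM.
  have Phi0 : root (map_poly (in_alg K) Phi) z.
    by rewrite map_poly_intr root_Cyclotomic.
  by rewrite (rootP Phi0) mulr0 add0r.
have sq : (size q <= totient n)%N.
  by rewrite -ltnS -sPhi ltn_modp -size_poly_eq0 sPhi.
pose r := map_poly (in_alg K) q - x%:P.
have r0 : r = 0.
  apply: contraTeq cardI => r_neq0; rewrite -ltnNge.
  have rs_uniq : uniq [seq s i z | i <- enum I] by rewrite map_inj_uniq ?enum_uniq.
  have := max_poly_roots r_neq0 _ rs_uniq; rewrite size_map -cardE => /(_ _)/leq_trans -> //.
    apply/allP => _ /mapP[i _ ->].
    rewrite /root /r !hornerE -(fix_x i) xq -horner_map -map_poly_comp.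
    rewrite (eq_map_poly (g := in_alg K)) ?subrr // => c /=.
    exact: etrans (fmorph_eq_rat (s i \o in_alg K) c) (esym (fmorph_eq_rat (in_alg K) c)).
  rewrite (leq_trans (size_polyD _ _)) // size_polyN geq_max size_map_poly sq /=.
  by rewrite (leq_trans (size_polyC_leq1 _)) // totient_gt0 (prim_order_gt0 z_prim).
exists q`_0; have /eqP : r`_0 = 0 by rewrite r0 coef0.
by rewrite /r coefB coefC coef_map subr_eq0 => /eqP <-.
Qed.

(** * Products of primitive roots and exponents prime to [n] *)

Lemma prim_root_mul (F : fieldType) (m n : nat) (x y : F) : coprime m n ->
  m.-primitive_root x -> n.-primitive_root y -> (m * n).-primitive_root (x * y).
Proof.
move=> cop x_prim y_prim.
have [m_gt0 n_gt0] := (prim_order_gt0 x_prim, prim_order_gt0 y_prim).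
have xy1 : (x * y) ^+ (m * n) = 1.
  rewrite exprMn exprM mulnC exprM.
  by rewrite !(prim_expr_order x_prim, prim_expr_order y_prim) !expr1n mulr1.
have [d d_prim d_dvd] := prim_order_exists (n := m * n) (ltac:(by rewrite muln_gt0 m_gt0)) xy1.
suff -> : (m * n)%N = d by [].
have xy1' : (x * y) ^+ d = 1 := prim_expr_order d_prim.
apply/eqP; rewrite eqn_dvd d_dvd andbT Gauss_dvd //; apply/andP; split.
  rewrite -(Gauss_dvdl d cop) (prim_order_dvd x_prim) exprM.
  have := congr1 (fun u => u ^+ n) xy1'; rewrite exprMn expr1n exprMn.
  by rewrite [y ^+ d ^+ n]exprAC (prim_expr_order y_prim) expr1n mulr1 => ->.
rewrite coprime_sym in cop.
rewrite -(Gauss_dvdl d cop) (prim_order_dvd y_prim) exprM.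
have := congr1 (fun u => u ^+ m) xy1'; rewrite exprMn expr1n exprMn.
by rewrite [x ^+ d ^+ m]exprAC (prim_expr_order x_prim) expr1n mul1r => ->.
Qed.

Definition unit_exp (n : nat) : finType := {s : 'I_n | coprime s n}.

Definition uval (n : nat) (s : unit_exp n) : nat := val (val s).

Lemma uval_inj (n : nat) : injective (@uval n).
Proof. by move=> s t st; apply/val_inj/val_inj. Qed.

Lemma uval_coprime (n : nat) (s : unit_exp n) : coprime (uval s) n.
Proof. exact: (valP s). Qed.

Lemma uval_lt (n : nat) (s : unit_exp n) : (uval s < n)%N.
Proof. exact: ltn_ord. Qed.

Lemma card_unit_exp (n : nat) : #|{: unit_exp n}| = totient n.
Proof.
rewrite card_sig totient_count_coprime big_mkord -sum1_card [LHS]big_mkcond /=.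
by apply: eq_bigr => i _; rewrite inE coprime_sym; case: coprime.
Qed.

Lemma unit_exp_exists (n k : nat) : (0 < n)%N -> coprime k n ->
  exists s : unit_exp n, uval s == (k %% n)%N.
Proof.
move=> n_gt0 k_cop; have k_lt : (k %% n < n)%N by rewrite ltn_mod.
have cop : coprime (Ordinal k_lt) n by rewrite /= coprime_modl.
by exists (exist _ (Ordinal k_lt) cop).
Qed.

(* 1 mod n, which is 0 for n = 1. *)
Definition unit_exp1 (n : nat) (n_gt0 : (0 < n)%N) : unit_exp n :=
  xchoose (unit_exp_exists n_gt0 (coprime1n n)).

Lemma uval1 (n : nat) (n_gt0 : (0 < n)%N) : uval (unit_exp1 n_gt0) = (1 %% n)%N.
Proof. exact/eqP/(xchooseP (unit_exp_exists n_gt0 (coprime1n n))). Qed.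

(** * Automorphisms and traces of a cyclotomic field *)

Section Rotations.

Variables (K : fieldExtType rat) (M N : nat) (zeta xi : K).
Hypotheses (zeta_prim : M.-primitive_root zeta) (xi_prim : N.-primitive_root xi).
Hypothesis cop : coprime M N.
Hypothesis z_gen : cyclotomic_generator (M * N) (zeta * xi).

Let M_gt0 : (0 < M)%N := prim_order_gt0 zeta_prim.
Let N_gt0 : (0 < N)%N := prim_order_gt0 xi_prim.

(** Index set of the Galois group of [K] over Q, split as (Z/M)^* x (Z/N)^* by the coprimality of
    [M] and [N]. *)
Definition gamma : finType := (unit_exp M * unit_exp N)%type.

Definition conjugate (i : gamma) : K := zeta ^+ uval i.1 * xi ^+ uval i.2.

Lemma conjugate_prim (i : gamma) : (M * N).-primitive_root (conjugate i).
Proof.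
by apply: prim_root_mul; rewrite // prim_root_exp_coprime // uval_coprime.
Qed.

Definition rot (i : gamma) : {rmorphism K -> K} := rotation z_gen (conjugate_prim i).

Lemma rot_gen (i : gamma) : rot i (zeta * xi) = conjugate i.
Proof. exact: rotation_gen. Qed.

Lemma rot_zeta (i : gamma) : rot i zeta = zeta ^+ uval i.1.
Proof.
(* As [e] is 1 modulo [M] and 0 modulo [N], [zeta] is the [e]-th power of the generator, on which
   [rot i] is known. *)
pose e := chinese M N 1 0.
have zeta_e : zeta ^+ e = zeta.
  by apply/eqP; rewrite -{2}[zeta]expr1 (eq_prim_root_expr zeta_prim) chinese_modl.
have xi_e : xi ^+ e = 1.
  by apply/eqP; rewrite -[1](expr0 xi) (eq_prim_root_expr xi_prim) chinese_modr.
have zetaE : zeta = (zeta * xi) ^+ e by rewrite exprMn zeta_e xi_e mulr1.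
rewrite {1}zetaE rmorphXn rot_gen /conjugate exprMn -!exprM ![(_ * e)%N]mulnC !exprM.
by rewrite zeta_e xi_e expr1n mulr1.
Qed.

Lemma rot_xi (i : gamma) : rot i xi = xi ^+ uval i.2.
Proof.
apply: (mulfI (_ : rot i zeta != 0)); last by rewrite -rmorphM rot_gen rot_zeta.
by rewrite fmorph_eq0 (prim_root_eq0 zeta_prim) -lt0n.
Qed.

Lemma eq_rot (L : fieldType) (f g : {rmorphism K -> L}) :
  f (zeta * xi) = g (zeta * xi) -> f =1 g.
Proof. exact: eq_rmorphism_gen z_gen. Qed.

Definition gamma1 : gamma := (unit_exp1 M_gt0, unit_exp1 N_gt0).

Lemma rot1 : rot gamma1 =1 id.
Proof.
apply: (eq_rot (g := idfun)); rewrite rot_gen /conjugate !uval1.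
by rewrite (prim_expr_mod zeta_prim) (prim_expr_mod xi_prim).
Qed.

Lemma rot_inj (i j : gamma) : rot i (zeta * xi) = rot j (zeta * xi) -> i = j.
Proof.
move=> /(@eq_rot _ (rot i) (rot j)) ij; case: i j ij => [s t] [s' t'] ij; congr (_, _).
  have /eqP := ij zeta; rewrite !rot_zeta (eq_prim_root_expr zeta_prim) !modn_small ?uval_lt //.
  by move/eqP/uval_inj.
have /eqP := ij xi; rewrite !rot_xi (eq_prim_root_expr xi_prim) !modn_small ?uval_lt //.
by move/eqP/uval_inj.
Qed.

Lemma rot_comp (i j : gamma) : exists k, rot i \o rot j =1 rot k.
Proof.
have cs : coprime (uval i.1 * uval j.1) M by rewrite coprimeMl !uval_coprime.
have ct : coprime (uval i.2 * uval j.2) N by rewrite coprimeMl !uval_coprime.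
have [s /eqP hs] := unit_exp_exists M_gt0 cs; have [t /eqP ht] := unit_exp_exists N_gt0 ct.
exists (s, t); apply: (@eq_rot _ (rot i \o rot j) (rot (s, t))).
rewrite [RHS]rot_gen /conjugate /= rot_gen rmorphM !rmorphXn rot_zeta rot_xi.
by rewrite hs ht -!exprM (prim_expr_mod zeta_prim) (prim_expr_mod xi_prim).
Qed.

Lemma rot_comm (i j : gamma) (x : K) : rot i (rot j x) = rot j (rot i x).
Proof.
apply: (@eq_rot _ (rot i \o rot j) (rot j \o rot i)) => /=.
rewrite !rot_gen /conjugate !rmorphM !rmorphXn !rot_zeta !rot_xi -!exprM.
by congr (_ ^+ _ * _ ^+ _); rewrite mulnC.
Qed.

(** Translation by [rot j] permutes the Galois group. An arbitrary commutative operation covers both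
    traces and norms. *)
Lemma big_rot_comp (R : Type) (idx : R) (op : Monoid.com_law idx) (F : K -> R)
    (j : gamma) (x : K) :
  \big[op/idx]_i F (rot j (rot i x)) = \big[op/idx]_i F (rot i x).
Proof.
have h_ex i : exists k, conjugate k == rot j (conjugate i).
  by have [k jik] := rot_comp j i; exists k; rewrite -!rot_gen -jik.
pose h i := xchoose (h_ex i).
have hE i : rot (h i) =1 rot j \o rot i.
  apply: eq_rot; rewrite [LHS]rot_gen (eqP (xchooseP (h_ex i))) -rot_gen.
  by [].
have h_inj : injective h.
  move=> a b hab; apply: rot_inj; apply: (fmorph_inj (rot j)).
  by have := hE a (zeta * xi); rewrite hab hE.
by rewrite [RHS](reindex_inj h_inj) /=; apply: eq_bigr => i _; rewrite hE.
Qed.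

Definition gtrace (x : K) : K := \sum_i rot i x.

Lemma card_gamma : #|gamma| = totient (M * N).
Proof. by rewrite card_prod !card_unit_exp totient_coprime. Qed.

Lemma rot_fixed_rational (x : K) : (forall i, rot i x = x) -> exists c, x = c%:A.
Proof.
apply: (fixed_rational z_gen) => [i j|]; first exact: rot_inj.
by rewrite card_gamma.
Qed.

Notation integral := (integralOver (intr : int -> K)).

Lemma rot_integral (i : gamma) (x : K) : integral x -> integral (rot i x).
Proof.
case=> p p_mon px; exists p => //.
by rewrite -(map_poly_intr (rot i)) fmorph_root.
Qed.

Lemma rot_fixed_int (x : K) :
  integral x -> (forall i, rot i x = x) -> exists m : int, x = m%:~R.
Proof.
move=> x_int /rot_fixed_rational[c xc]; move: x_int; rewrite xc => /integral_rat/intrP[m ->].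
by exists m; rewrite scaler_int.
Qed.

Lemma gtrace_is_zmod_morphism : zmod_morphism gtrace.
Proof. by move=> x y; rewrite /gtrace -sumrB; apply: eq_bigr => i _; rewrite rmorphB. Qed.

HB.instance Definition _ := GRing.isZmodMorphism.Build K K gtrace gtrace_is_zmod_morphism.

Lemma rot_gtrace (j : gamma) (x : K) : rot j (gtrace x) = gtrace x.
Proof. by rewrite rmorph_sum; apply: (big_rot_comp +%R id). Qed.

Lemma gtrace_rot (j : gamma) (x : K) : gtrace (rot j x) = gtrace x.
Proof. by rewrite -[RHS](rot_gtrace j) rmorph_sum; apply: eq_bigr => i _; rewrite rot_comm. Qed.

Lemma gtrace_rational (x : K) : exists c, gtrace x = c%:A.
Proof. by apply: rot_fixed_rational => j; apply: rot_gtrace. Qed.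

Lemma integral_sum (I : Type) (r : seq I) (P : pred I) (F : I -> K) :
  (forall i, P i -> integral (F i)) -> integral (\sum_(i <- r | P i) F i).
Proof.
move=> F_int; elim/big_ind: _ => //; first exact: mxpoly.integral0.
by move=> x y; apply: integral_add.
Qed.

Lemma gtrace_int (x : K) : integral x -> exists m : int, gtrace x = m%:~R.
Proof.
move=> x_int; apply: rot_fixed_int => [|j]; last exact: rot_gtrace.
by apply: integral_sum => i _; apply: rot_integral.
Qed.

Lemma gtrace_inversion (v : K) :
  \sum_(k < M * N) gtrace (v * (zeta * xi) ^- k) * (zeta * xi) ^+ k = (M * N)%:R * v.
Proof.
have [z_prim _ _] := z_gen.
apply: (aut_sum_inversion rot1); rewrite ?muln_gt0 ?M_gt0 //; first exact: prim_expr_order.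
move=> i; apply/eqP/eqP => [|->]; last exact: rot1.
by rewrite -{2}(rot1 (zeta * xi)) => /rot_inj.
Qed.

(** By [gtrace_inversion], the powers z^k and the functionals v |-> l(v z^-k) / (MN) act like a
    basis and its dual, although these powers are in general linearly dependent. The trace of
    multiplication by [x] thus becomes the mean of MN terms, each equal to l(x). *)
Lemma field_traceE (x : K) : (field_trace x)%:A = gtrace x.
Proof.
pose z := zeta * xi.
have l_ex v : exists c : rat, gtrace v == c%:A by have [c ->] := gtrace_rational v; exists c.
pose l v := xchoose (l_ex v).
have lE v : (l v)%:A = gtrace v :> K by rewrite -(eqP (xchooseP (l_ex v))).
have MN0 : (M * N)%:R != 0 :> rat by rewrite pnatr_eq0 -lt0n muln_gt0 M_gt0.
have lD u v : l (u + v) = l u + l v.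
  by apply: (fmorph_inj (in_alg K)) => /=; rewrite scalerDl !lE raddfD.
have lZ c v : l (c *: v) = c * l v.
  apply: (fmorph_inj (in_alg K)) => /=; rewrite -scalerA !lE -mulr_algl mulr_sumr.
  apply: eq_bigr => i _; rewrite -[c *: v]mulr_algl rmorphM; congr (_ * _).
  exact: etrans (fmorph_eq_rat (rot i \o in_alg K) c) (esym (fmorph_eq_rat (in_alg K) c)).
have l0 : l 0 = 0 by have := lZ 0 0; rewrite scale0r mul0r.
have decomp v : v = \sum_(k < M * N) ((M * N)%:R^-1 * l (v * z ^- k)) *: z ^+ k.
  apply: (scalerI MN0); rewrite [LHS]scaler_nat -[LHS]mulr_natl -gtrace_inversion scaler_sumr.
  by apply: eq_bigr => k _; rewrite scalerA mulVKf // -mulr_algl lE.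
rewrite -lE /field_trace /mxtrace; congr (_%:A).
pose e := vbasis {:K}.
have coordE v : v = \sum_i coord e i v *: e`_i by apply: coord_vbasis; rewrite memvf.
under eq_bigr => i _.
  rewrite mxE (decomp e`_i) mulr_sumr linear_sum /=.
  under eq_bigr => k _ do rewrite -scalerAr linearZ /=.
  over.
rewrite exchange_big /=.
transitivity (\sum_(k < M * N) (M * N)%:R^-1 * l (x * z ^+ k * z ^- k)).
  apply: eq_bigr => k _; rewrite {2}(coordE (x * z ^+ k)) mulr_suml (big_morph l lD l0) mulr_sumr.
  by apply: eq_bigr => i _; rewrite -scalerAl lZ; ring.
have z0 : z != 0.
  by rewrite (prim_root_eq0 (prim_root_mul cop zeta_prim xi_prim)) -lt0n muln_gt0 M_gt0.
under eq_bigr => k _ do rewrite mulfK ?expf_neq0 //.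
by rewrite sumr_const card_ord -[LHS]mulr_natl mulVKf.
Qed.

Lemma zeta_unity (j : nat) : (zeta ^+ j) ^+ M = 1.
Proof. by rewrite exprAC (prim_expr_order zeta_prim) expr1n. Qed.

Lemma zeta_neq0 : zeta != 0.
Proof. by rewrite (prim_root_eq0 zeta_prim) -lt0n. Qed.

(** The trace from [K] to Q(xi), that is, Tr_G of the overview: these rotations fix [xi]. For [M] a
    power of p they form the inertia group at p. *)
Definition inertia_trace (x : K) : K := \sum_(s : unit_exp M) rot (s, unit_exp1 N_gt0) x.

(** * The form Tr(x x^* ) *)

Section NormForm.

Variables (R : realType) (incl : {rmorphism K -> R[i]}) (star : K -> K).
Hypothesis starE : forall x, incl (star x) = (incl x)^*%C.

Definition nsq (w : R[i]) : R := complex.Re w ^+ 2 + complex.Im w ^+ 2.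

Lemma nsq_ge0 (w : R[i]) : 0 <= nsq w.
Proof. by rewrite addr_ge0 ?sqr_ge0. Qed.

Lemma nsqM (v w : R[i]) : nsq (v * w) = nsq v * nsq w.
Proof. by case: v w => [a b] [c d]; rewrite /nsq /=; ring. Qed.

Lemma nsq1 : nsq 1 = 1. Proof. by rewrite /nsq /= expr1n expr0n addr0. Qed.

Lemma mul_conj (w : R[i]) : w * w^*%C = (nsq w)%:C%C.
Proof.
case: w => [a b]; rewrite /nsq /=; apply/eqP; rewrite eq_complex /=.
by apply/andP; split; apply/eqP; ring.
Qed.

Lemma nsq_unity (w : R[i]) (n : nat) : (0 < n)%N -> w ^+ n = 1 -> nsq w = 1.
Proof.
move=> n_gt0 wn1; have : nsq w ^+ n = 1.
  by rewrite -nsq1 -wn1; elim: (n) => [|k IHk]; rewrite ?nsq1 // !exprS nsqM IHk.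
by move/eqP; rewrite pexpr_eq1 // ?nsq_ge0 // => /eqP.
Qed.

Lemma star_zmod : zmod_morphism star.
Proof. by move=> x y; apply: (fmorph_inj incl); rewrite rmorphB /= !starE !rmorphB. Qed.

Lemma star_monoid : monoid_morphism star.
Proof.
split; first by apply: (fmorph_inj incl); rewrite /= starE !rmorph1.
by move=> x y; apply: (fmorph_inj incl); rewrite rmorphM /= !starE !rmorphM.
Qed.

HB.instance Definition _ := GRing.isZmodMorphism.Build K K star star_zmod.
HB.instance Definition _ := GRing.isMonoidMorphism.Build K K star star_monoid.

Lemma star_unity (y : K) (n : nat) : (0 < n)%N -> y ^+ n = 1 -> star y = y^-1.
Proof.
move=> n_gt0 yn1; have y0 : y != 0.
  by apply/eqP => y0; move/eqP: yn1; rewrite y0 expr0n gtn_eqF // eq_sym oner_eq0.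
apply: (mulfI y0); rewrite divff //; apply: (fmorph_inj incl).
rewrite rmorphM /= starE mul_conj (nsq_unity n_gt0) ?rmorph1 //.
by rewrite -rmorphXn yn1 rmorph1.
Qed.

(** Conjugation inverts roots of unity, so both composites send the generator to the inverse of its
    conjugate. *)
Lemma star_rot (i : gamma) (x : K) : star (rot i x) = rot i (star x).
Proof.
have MN_gt0 : (0 < M * N)%N by rewrite muln_gt0 M_gt0.
apply: (@eq_rot _ (star \o rot i) (rot i \o star)) => /=.
rewrite rot_gen (star_unity MN_gt0 (prim_expr_order (conjugate_prim i))).
rewrite (@star_unity (zeta * xi) _ MN_gt0) ?fmorphV ?rot_gen //.
by have [z_prim _ _] := z_gen; apply: prim_expr_order.
Qed.

(** This is Tr(x x^* ) written as a sum of squared absolute values; [field_trace_nform] gives the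
    equality. *)
Definition nform (x : K) : R := \sum_i nsq (incl (rot i x)).

Lemma nformC (x : K) : (nform x)%:C%C = incl (gtrace (x * star x)).
Proof.
rewrite /gtrace /nform !rmorph_sum; apply: eq_bigr => i _ /=.
by rewrite !rmorphM /= -star_rot starE mul_conj.
Qed.

Lemma field_trace_nform (x : K) : ratr (field_trace (x * star x)) = nform x.
Proof.
apply: (fmorph_inj (real_complex R)); rewrite /= nformC -field_traceE.
exact: etrans (fmorph_eq_rat (real_complex R \o ratr) _)
              (esym (fmorph_eq_rat (incl \o in_alg K) _)).
Qed.

Lemma nform_ge0 (x : K) : 0 <= nform x.
Proof. by apply: sumr_ge0 => i _; apply: nsq_ge0. Qed.

Lemma nform0 : nform 0 = 0.
Proof. by rewrite /nform big1 // => i _; rewrite !rmorph0 /nsq /= expr0n addr0. Qed.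

Lemma nform_le3 (x y w : K) : nform (x + y - w) <= 3 * (nform x + nform y + nform w).
Proof.
rewrite /nform -!big_split mulr_sumr; apply: ler_sum => i _; rewrite !rmorphB !rmorphD /nsq /=.
case: (incl (rot i x)) (incl (rot i y)) (incl (rot i w)) => [a b] [c d] [e f] /=.
rewrite -subr_ge0 [leRHS](_ : _ = (a - c) ^+ 2 + (a + e) ^+ 2 + (c + e) ^+ 2
  + (b - d) ^+ 2 + (b + f) ^+ 2 + (d + f) ^+ 2); last by ring.
by rewrite !addr_ge0 ?sqr_ge0.
Qed.

Lemma nform_le2 (x y : K) : nform (x - y) <= 2 * (nform x + nform y).
Proof.
rewrite /nform -!big_split mulr_sumr; apply: ler_sum => i _; rewrite !rmorphB /nsq /=.
case: (incl (rot i x)) (incl (rot i y)) => [a b] [c d] /=.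
rewrite -subr_ge0 [leRHS](_ : _ = (a + c) ^+ 2 + (b + d) ^+ 2); last by ring.
by rewrite !addr_ge0 ?sqr_ge0.
Qed.

(** The product of the squared absolute values of the conjugates is the square of the norm, a
    nonzero rational integer, hence at least 1. AM-GM passes from the product to the sum. *)
Lemma nform_integral_ge (x : K) : integral x -> x != 0 -> #|gamma|%:R <= nform x.
Proof.
move=> x_int x0; set d := #|gamma|.
have d_gt0 : (0 < d)%N by apply/card_gt0P; exists gamma1.
have norm_int : integral (\prod_i rot i x).
  elim/big_ind: _ => [|u v|i _]; [exact: integral1|exact: integral_mul|exact: rot_integral].
have norm_fix j : rot j (\prod_i rot i x) = \prod_i rot i x.
  by rewrite rmorph_prod; apply: (big_rot_comp *%R id).
have [m norm_m] := rot_fixed_int norm_int norm_fix.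
have m0 : m != 0.
  have : \prod_i rot i x != 0 by apply/prodf_neq0 => i _; rewrite fmorph_eq0.
  by rewrite norm_m; apply: contra_neq => ->.
have prodE : \prod_i nsq (incl (rot i x)) = m%:~R ^+ 2.
  have -> : \prod_i nsq (incl (rot i x)) = nsq (incl (\prod_i rot i x)).
    by rewrite rmorph_prod (big_morph nsq nsqM nsq1).
  rewrite norm_m rmorph_int /nsq -(rmorph_int (real_complex R)) /=.
  by rewrite expr0n addr0.
have [AGM _] := @leif_AGM R gamma predT (fun i => nsq (incl (rot i x))) (fun i _ => nsq_ge0 _).
have : 1 <= (nform x / d%:R) ^+ d.
  by apply: le_trans AGM; rewrite prodE sqr_intr_ge1 ?intr_int // intr_eq0.
rewrite expr_ge1 //; last by rewrite divr_ge0 ?nform_ge0 ?ler0n.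
by rewrite ler_pdivlMr ?ltr0n // mul1r.
Qed.

Lemma nform_small (x : K) : integral x -> nform x < #|gamma|%:R -> x = 0.
Proof.
move=> x_int; apply: contraTeq => x0; rewrite -leNgt.
exact: nform_integral_ge.
Qed.

(* If more than half of the [f k] were short, then every class [m b] would be
   the difference of two short terms, up to integers. Short representatives of
   the classes are unique, hence additive in [m], hence zero. *)
Lemma progression_bound (p : nat) (f : nat -> K) (b : K) :
  (0 < p)%N -> (forall k, f (k + p)%N = f k) ->
  (forall k, integral (f k.+1 - f k - b)) -> ~ integral b ->
  p%:R * #|gamma|%:R <= 98 * \sum_(k < p) nform (f k).
Proof.
move=> p_gt0 f_per f_step b_nint; set d : R := #|gamma|%:R.
have d_ge0 : 0 <= d by apply: ler0n.
have d_gt0 : 0 < d by rewrite ltr0n; apply/card_gt0P; exists gamma1.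
have f_mod k : f (k %% p)%N = f k.
  rewrite {2}(divn_eq k p) addnC; elim: (k %/ p)%N => [|q ->]; first by rewrite addn0.
  by rewrite mulSnr addnA f_per.
have f_steps k m : integral (f (k + m)%N - f k - b *+ m).
  elim: m => [|m IHm]; first by rewrite addn0 subrr subr0; apply: mxpoly.integral0.
  have -> : f (k + m.+1)%N - f k - b *+ m.+1 =
      (f (k + m).+1 - f (k + m)%N - b) + (f (k + m)%N - f k - b *+ m).
    by rewrite addnS mulrS; ring.
  exact: integral_add.
(* Differences of two short terms have form less than 4d/49, and [nform_le3] bounds a combination of
   three of these by 36d/49 < d, which forces an integral one to vanish. If half of the terms are
   not short, the sum is at least (p/2)(d/49), whence 98. *)
pose S := [set k : 'I_p | 49 * nform (f k) < d].
have [S_small|S_big] := leqP (2 * #|S|) p.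
  have : \sum_(k < p | k \notin S) nform (f k) <= \sum_(k < p) nform (f k).
    by rewrite [leRHS](bigID (fun k => k \notin S)) /= lerDl sumr_ge0 // => k _; apply: nform_ge0.
  have : (#|~: S|%:R * d) <= 49 * \sum_(k < p | k \notin S) nform (f k).
    rewrite mulr_sumr (eq_bigl (fun k => k \in ~: S)); last by move=> k; rewrite !inE.
    rewrite -sumr_const mulr_suml; apply: ler_sum => k.
    by rewrite !inE -leNgt mul1r.
  have : p%:R * d <= 2 * (#|~: S|%:R * d).
    rewrite mulrA ler_wpM2r // -natrM ler_nat.
    by have := cardsC S; rewrite card_ord; lia.
  by lra.
exfalso.
have short m : exists2 y, integral (y - b *+ m) & 49 * nform y < 4 * d.
  have h_lt (k : 'I_p) : ((k + m) %% p < p)%N by rewrite ltn_mod.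
  pose h k := Ordinal (h_lt k).
  have h_inj : injective h.
    move=> k l /(congr1 val)/= /eqP; rewrite eqn_modDr !modn_small // => /eqP.
    exact: val_inj.
  (* [S] and its preimage under translation by [m] have together more than [p] elements, so they
     meet. *)
  have [k kS hkS] : exists2 k, k \in S & h k \in S.
    have : (0 < #|S :&: h @^-1: S|)%N.
      have := cardsUI S (h @^-1: S); rewrite (card_preimset S h_inj).
      have := subset_leq_card (finset.subsetT (S :|: h @^-1: S)); rewrite cardsT card_ord; lia.
    by case/card_gt0P => k; rewrite !inE => /andP[kS hkS]; exists k; rewrite !inE.
  exists (f (k + m)%N - f k); first exact: f_steps.
  move: kS hkS; rewrite !inE /= f_mod; have := nform_le2 (f (k + m)%N) (f k).
  by lra.
have [y1 y1_int y1_short] := short 1%N.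
have unique m y : integral (y - b *+ m) -> 49 * nform y < 4 * d -> y = y1 *+ m.
  elim: m y => [|m IHm] y y_int y_short.
    by apply: nform_small; rewrite ?subr0 // in y_int *; rewrite -/d; lra.
  have [u u_int u_short] := short m.
  have : u + y1 - y = 0.
    apply: nform_small; last by rewrite -/d; have := nform_le3 u y1 y; lra.
    have -> : u + y1 - y = (u - b *+ m) + (y1 - b *+ 1) - (y - b *+ m.+1).
      by rewrite mulr1n mulrS; ring.
    by apply: integral_sub => //; apply: integral_add.
  move/eqP; rewrite subr_eq0 => /eqP <-.
  by rewrite (IHm u) // mulrSr.
(* By periodicity [b *+ p] is integral, so 0 is a short representative of its class. Hence p y1 = 0,
   then y1 = 0, and [b] is integral. *)
have : 0 = y1 *+ p.
  apply: unique; last by rewrite nform0 mulr0; lra.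
  by have := f_steps 0%N p; rewrite f_per subrr.
move/esym/eqP; rewrite -mulr_natr mulf_eq0 fieldExt_natr_eq0 gtn_eqF // orbF => /eqP y10.
by apply: b_nint; have := integral_opp y1_int; rewrite y10 mulr1n sub0r opprK.
Qed.

(** On expanding the products, the sum over i is geometric in the ratio of two conjugates of [zeta]
    and kills the off-diagonal terms; what remains is M Tr_G(w w^* ). The full trace of each of its
    phi(M) summands is the same. *)
Lemma inertia_parseval (w : K) :
  \sum_(i < M) nform (inertia_trace (w * zeta ^- i)) = (M * totient M)%:R * nform w.
Proof.
apply: (fmorph_inj (real_complex R)); rewrite rmorph_sum rmorphM rmorph_nat /= nformC.
under eq_bigr => i _ do rewrite nformC.
rewrite -rmorph_sum -raddf_sum /=.
have -> : \sum_(i < M) inertia_trace (w * zeta ^- i) * star (inertia_trace (w * zeta ^- i)) =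
    M%:R * \sum_(s : unit_exp M) rot (s, unit_exp1 N_gt0) (w * star w).
  pose r s := rot (s, unit_exp1 N_gt0).
  transitivity (\sum_s \sum_t r s w * r t (star w) * \sum_(i < M) (r t zeta / r s zeta) ^+ i).
    under eq_bigr => i _.
      rewrite rmorph_sum mulr_suml /=.
      under eq_bigr => s _ do rewrite mulr_sumr.
      over.
    rewrite exchange_big; apply: eq_bigr => s _; rewrite exchange_big; apply: eq_bigr => t _.
    rewrite mulr_sumr; apply: eq_bigr => i _.
    rewrite star_rot rmorphM rmorphM /= (@star_unity (zeta ^- i) M) //; last first.
      by rewrite exprVn zeta_unity invr1.
    by rewrite invrK rmorphM /= !fmorphV !rmorphXn exprMn exprVn; ring.
  rewrite mulr_sumr; apply: eq_bigr => s _; rewrite (bigD1 s) //= [X in _ + X]big1 ?addr0.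
    rewrite divff ?fmorph_eq0 ?zeta_neq0 //; under eq_bigr do rewrite expr1n.
    by rewrite sumr_const card_ord rmorphM mulrC.
  move=> t ts; rewrite sum_expr_unity; last first.
    by rewrite exprMn exprVn !rot_zeta !zeta_unity divr1.
  rewrite [_ == 1](_ : _ = false) ?mulr0 //; apply: contraNF ts => /eqP/divr1_eq.
  rewrite !rot_zeta => /eqP; rewrite (eq_prim_root_expr zeta_prim) !modn_small ?uval_lt //.
rewrite mulr_natl raddfMn raddf_sum /=.
under eq_bigr => s _ do rewrite gtrace_rot.
by rewrite sumr_const card_unit_exp -mulrnA mulnC rmorphMn /= mulr_natl.
Qed.

(** * Integrality of traces at a prime power *)

Section PrimePower.

Variables (p e : nat).
Hypotheses (p_prime : prime p) (ME : M = (p ^ e.+1)%N).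
(** M/p, so that [zeta ^+ g] is the primitive p-th root omega of the overview. *)
Let g := (p ^ e)%N.

Let p_gt0 : (0 < p)%N := prime_gt0 p_prime.
Let g_gt0 : (0 < g)%N. Proof. by rewrite expn_gt0 p_gt0. Qed.
Let MgE : M = (g * p)%N. Proof. by rewrite ME expnSr. Qed.

Lemma coprime_M (j : nat) : coprime j M = ~~ (p %| j)%N.
Proof. by rewrite coprime_sym ME coprime_pexpl // prime_coprime. Qed.

Lemma big_unit_exp (T : Type) (idx : T) (op : Monoid.com_law idx) (F : nat -> T) :
  \big[op/idx]_(s : unit_exp M) F (uval s) = \big[op/idx]_(i < M | ~~ (p %| i)%N) F i.
Proof.
transitivity (\big[op/idx]_(i < M | coprime i M) F i).
  by rewrite (big_sub _ (fun i : 'I_M => F i)).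
by apply: eq_bigl => i; rewrite coprime_M.
Qed.

(** The exponents prime to p are all exponents minus the multiples of p, and both resulting sums are
    geometric. *)
Lemma ramanujan_sum (j : nat) :
  \sum_(s : unit_exp M) zeta ^+ (uval s * j) =
  (if (M %| j)%N then M%:R else 0) - (if (g %| j)%N then g%:R else 0).
Proof.
have full : \sum_(i < M) zeta ^+ (i * j) = if (M %| j)%N then M%:R else 0.
  under eq_bigr => i _ do rewrite mulnC exprM.
  by rewrite sum_expr_unity ?zeta_unity // (prim_order_dvd zeta_prim).
have mult : \sum_(i < M | (p %| i)%N) zeta ^+ (i * j) = if (g %| j)%N then g%:R else 0.
  rewrite [in LHS]MgE (big_ord_multiples _ _ (fun i => zeta ^+ (i * j))) //.
  under eq_bigr => i _ do rewrite -mulnA mulnC exprM.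
  rewrite sum_expr_unity; last first.
    by rewrite -exprM mulnAC [(p * g)%N]mulnC -MgE exprM (prim_expr_order zeta_prim) expr1n.
  by rewrite -(prim_order_dvd zeta_prim) MgE mulnC dvdn_pmul2l.
rewrite (big_unit_exp _ (fun i => zeta ^+ (i * j))) -full -mult.
by rewrite [X in X - _](bigID (fun i : 'I_M => (p %| i)%N)) /= addrC addrK.
Qed.

(** * The ring Z[zeta] and its element pi = 1 - zeta above p *)

Definition in_Zzeta (x : K) := exists q : {poly int}, x = (map_poly intr q).[zeta].

Lemma Zzeta_int (m : int) : in_Zzeta m%:~R.
Proof. by exists m%:P; rewrite map_polyC hornerC. Qed.

Lemma Zzeta_zeta : in_Zzeta zeta.
Proof. by exists 'X; rewrite map_polyX hornerX. Qed.

Lemma Zzeta_add (x y : K) : in_Zzeta x -> in_Zzeta y -> in_Zzeta (x + y).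
Proof. by move=> [q ->] [r ->]; exists (q + r); rewrite rmorphD hornerD. Qed.

Lemma Zzeta_mul (x y : K) : in_Zzeta x -> in_Zzeta y -> in_Zzeta (x * y).
Proof. by move=> [q ->] [r ->]; exists (q * r); rewrite rmorphM hornerM. Qed.

Lemma Zzeta_opp (x : K) : in_Zzeta x -> in_Zzeta (- x).
Proof. by move=> [q ->]; exists (- q); rewrite rmorphN hornerN. Qed.

Lemma Zzeta_sum (I : Type) (r : seq I) (P : pred I) (F : I -> K) :
  (forall i, P i -> in_Zzeta (F i)) -> in_Zzeta (\sum_(i <- r | P i) F i).
Proof. by move=> HF; elim/big_ind: _ => //; [apply: (Zzeta_int 0)|apply: Zzeta_add]. Qed.

Lemma Zzeta_prod (I : Type) (r : seq I) (P : pred I) (F : I -> K) :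
  (forall i, P i -> in_Zzeta (F i)) -> in_Zzeta (\prod_(i <- r | P i) F i).
Proof. by move=> HF; elim/big_ind: _ => //; [apply: (Zzeta_int 1)|apply: Zzeta_mul]. Qed.

Lemma Zzeta_exp (x : K) (k : nat) : in_Zzeta x -> in_Zzeta (x ^+ k).
Proof.
move=> xZ; elim: k => [|k IHk]; first exact: (Zzeta_int 1).
by rewrite exprS; apply: Zzeta_mul.
Qed.

Lemma Zzeta_horner (q : {poly int}) (x : K) : in_Zzeta x -> in_Zzeta (map_poly intr q).[x].
Proof.
move=> xZ; rewrite horner_coef; apply: Zzeta_sum => i _; rewrite coef_map.
by apply: Zzeta_mul; [apply: Zzeta_int|apply: Zzeta_exp].
Qed.

Lemma integral_int (m : int) : integral m%:~R.
Proof. exact: integral_id. Qed.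

Lemma integral_zeta : integral zeta.
Proof.
exists ('X^M - 1); first by rewrite monicXnsubC.
rewrite rmorphB rmorph1 /= map_polyXn.
by rewrite /root !hornerE (prim_expr_order zeta_prim) subrr.
Qed.

Lemma Zzeta_integral (x : K) : in_Zzeta x -> integral x.
Proof.
case=> q ->; apply: integral_horner; last exact: integral_zeta.
by apply/integral_poly => i; rewrite coef_map; apply: integral_int.
Qed.

Let pi1 : K := 1 - zeta.

(** Dividing the factorizations of X^M - 1 and X^g - 1 leaves the factors at the primitive roots,
    with quotient the sum of the X^(gi) for i < p. Its value at 1 is p. *)
Lemma prod_one_minus_zeta : \prod_(s : unit_exp M) (1 - zeta ^+ uval s) = p%:R.
Proof.
have zeta_p_prim : g.-primitive_root (zeta ^+ p).
  have -> : p = (M %/ g)%N by rewrite MgE mulKn.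
  by apply: dvdn_prim_root; rewrite // MgE dvdn_mulr.
pose F i : {poly K} := 'X - (zeta ^+ i)%:P.
have prod_mult : \prod_(i < M | (p %| i)%N) F i = 'X^g - 1.
  rewrite [in LHS]MgE big_ord_multiples // -(factor_Xn_sub_1 zeta_p_prim) big_mkord.
  by apply: eq_bigr => i _; rewrite /F mulnC exprM.
have prod_all : \prod_(i < M) F i = 'X^M - 1.
  by rewrite -(factor_Xn_sub_1 zeta_prim) big_mkord.
have : \prod_(s : unit_exp M) F (uval s) = \sum_(i < p) 'X^g ^+ i.
  have Xg1 : 'X^g - 1 != 0 :> {poly K} by rewrite -size_poly_eq0 size_XnsubC.
  apply: (mulfI Xg1); rewrite -subrX1 -exprM -MgE -prod_all -prod_mult.
  by rewrite big_unit_exp [RHS](bigID (fun i : 'I_M => (p %| i)%N)).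
move/(congr1 (horner^~ 1)); rewrite horner_prod horner_sum.
under eq_bigr => s _ do rewrite hornerXsubC.
by move=> ->; under eq_bigr => i _ do rewrite -exprM hornerXn expr1n; rewrite sumr_const card_ord.
Qed.

Lemma pi1_neq0 : pi1 != 0.
Proof.
rewrite subr_eq0 eq_sym -[zeta]expr1 -(prim_order_dvd zeta_prim) dvdn1 gtn_eqF //.
by rewrite MgE (leq_trans (prime_gt1 p_prime)) // leq_pmull.
Qed.

(** Each factor 1 - zeta^s of p is pi times a geometric sum. *)
Lemma p_div_pi1 : exists2 eps, in_Zzeta eps & p%:R = eps * pi1 ^+ totient M.
Proof.
exists (\prod_(s : unit_exp M) \sum_(i < uval s) zeta ^+ i).
  by apply: Zzeta_prod => s _; apply: Zzeta_sum => i _; apply/Zzeta_exp/Zzeta_zeta.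
rewrite -prod_one_minus_zeta -card_unit_exp -prodr_const -big_split /=.
by apply: eq_bigr => s _; rewrite mulrC -opprB -[pi1]opprB mulNr -subrX1.
Qed.

(** Conversely zeta = (zeta^s)^t with t inverse to s modulo M, so each 1 - zeta^s divides pi. Thus p
    and pi^phi(M) are associates in Z[zeta]. *)
Lemma pi1_div_p : exists2 eps, in_Zzeta eps & pi1 ^+ totient M = eps * p%:R.
Proof.
have inv_ex (s : unit_exp M) : exists t, (t * uval s == 1 %[mod M])%N.
  have s_gt0 : (0 < uval s)%N.
    by have := uval_coprime s; rewrite coprime_M; case: (uval s) => //; rewrite dvdn0.
  have /(coprimeP _ s_gt0)[[a b] /= ab] := uval_coprime s.
  by exists a; rewrite (_ : (a * uval s = b * M + 1)%N) ?modnMDl //; lia.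
exists (\prod_(s : unit_exp M) \sum_(i < xchoose (inv_ex s)) (zeta ^+ uval s) ^+ i).
  by apply: Zzeta_prod => s _; apply: Zzeta_sum => i _; do 2!apply: Zzeta_exp; apply: Zzeta_zeta.
rewrite -prod_one_minus_zeta -card_unit_exp -prodr_const -big_split /=.
apply: eq_bigr => s _; rewrite mulrC -[1 - zeta ^+ _]opprB mulNr -subrX1 opprB -exprM.
rewrite -(prim_expr_mod zeta_prim) mulnC (eqP (xchooseP (inv_ex s))).
by rewrite (prim_expr_mod zeta_prim).
Qed.

Lemma integral_exp (x : K) (k : nat) : integral x -> integral (x ^+ k).
Proof.
move=> x_int; elim: k => [|k IHk]; first exact: (integral_int 1).
by rewrite exprS; apply: integral_mul.
Qed.

Lemma totient_M_gt0 : (0 < totient M)%N.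
Proof. by rewrite totient_gt0. Qed.

(** Raising to the power phi(M) replaces pi by p up to a factor in Z[zeta]: m^phi(M) / p is integral
    and rational, so p divides m^phi(M), hence m. *)
Lemma int_div_pi1 (m : int) : integral (m%:~R / pi1) -> (p %| m)%Z.
Proof.
move=> /(integral_exp (totient M)) m_int; have [eps eps_Z pi1E] := pi1_div_p.
have p0 : p%:R != 0 :> rat by rewrite pnatr_eq0 -lt0n.
have : integral ((m ^+ totient M)%:~R / p%:R : rat)%:A.
  suff -> : ((m ^+ totient M)%:~R / p%:R : rat)%:A = (m%:~R / pi1) ^+ totient M * eps :> K.
    by apply: integral_mul => //; apply: Zzeta_integral.
  have pK0 : p%:R != 0 :> K by rewrite fieldExt_natr_eq0 -lt0n.
  rewrite -[LHS]/(in_alg K _) rmorphM fmorphV rmorph_int rmorph_nat rmorphXn.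
  rewrite exprMn exprVn pi1E.
  have eps0 : eps != 0.
    apply: contraTneq totient_M_gt0 => eps0; rewrite -leqNgt leqn0.
    by move/eqP: pi1E; rewrite eps0 mul0r expf_eq0 (negbTE pi1_neq0) andbF.
  by field; rewrite pK0 eps0.
move/integral_rat/intrP=> [n nE].
have : (p %| m ^+ totient M)%Z.
  apply/dvdzP; exists n; apply: (@intr_inj rat); rewrite rmorphM /= -nE.
  by rewrite -pmulrn divfK.
by rewrite !dvdzE abszX Euclid_dvdX // => /andP[].
Qed.

(* Writing p x as a polynomial in pi with integer coefficients, p divides the
   coefficients of index < phi(M) one after the other, as p ~ pi^phi(M). *)
Lemma Zzeta_of_pmul (x : K) : integral x -> in_Zzeta (p%:R * x) -> in_Zzeta x.
Proof.
move=> x_int [q qE].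
have [eps eps_Z pE] := p_div_pi1; have [eps' eps'_Z pi1E] := pi1_div_p.
have pi1_Z : in_Zzeta pi1 by apply/Zzeta_add/Zzeta_opp/Zzeta_zeta/(Zzeta_int 1).
have p0 : p%:R != 0 :> K by rewrite fieldExt_natr_eq0 -lt0n.
pose ev (r : {poly int}) : K := (map_poly intr r).[pi1].
have evZ r : in_Zzeta (ev r) by apply: Zzeta_horner.
(* Substituting 1 - X turns a polynomial in [zeta] into one in pi. *)
pose r := q \Po (1 - 'X).
have rE : p%:R * x = ev r.
  rewrite qE /ev /r map_comp_poly horner_comp rmorphB rmorph1 /= map_polyX !hornerE.
  by rewrite /pi1 subKr.
have split i : ev r = ev (take_poly i r) + ev (drop_poly i r) * pi1 ^+ i.
  by rewrite -{1}(poly_take_drop i r) /ev rmorphD rmorphM /= map_polyXn !hornerE.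
have take_div i : (forall j, (j < i)%N -> (p %| r`_j)%Z) ->
    exists2 t, in_Zzeta t & ev (take_poly i r) = p%:R * t.
  move=> p_dvd; exists (ev (\poly_(j < i) (r`_j %/ p)%Z)) => //.
  have -> : take_poly i r = p%:Z *: \poly_(j < i) (r`_j %/ p)%Z.
    apply/polyP => j; rewrite coefZ coef_take_poly coef_poly.
    case: ifP => ji; last by rewrite mulr0.
    by rewrite mulrC divzK ?p_dvd.
  by rewrite /ev map_polyZ hornerZ /= -pmulrn.
have p_dvd i : (i < totient M)%N -> (p %| r`_i)%Z.
  elim/ltn_ind: i => i IHi i_lt.
  have [t tZ tE] := take_div i (fun j ji => IHi j ji (ltn_trans ji i_lt)).
  apply: int_div_pi1.
  pose d' := drop_poly i.+1 r.
  have dropE : ev (drop_poly i r) = (r`_i)%:~R + pi1 * ev d'.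
    have -> : drop_poly i r = (r`_i)%:P + 'X * d'.
      apply/polyP => j; rewrite coefD coefC coefXM !coef_drop_poly.
      by case: j => [|j] /=; rewrite ?add0n ?addr0 // add0r addnS.
    by rewrite /ev rmorphD rmorphM /= map_polyC map_polyX !hornerE.
  (* The terms below index i contribute p t. Dividing p (x - t) = (r_i + pi d'(pi)) pi^i by pi^(i+1)
     and using p = eps pi^phi(M) exhibits r_i / pi as integral. *)
  have -> : (r`_i)%:~R / pi1 = eps * pi1 ^+ (totient M - i.+1) * (x - t) - ev d'.
    have pE' : p%:R = eps * (pi1 ^+ (totient M - i.+1) * (pi1 * pi1 ^+ i)).
      by rewrite pE -exprS -exprD subnK.
    have := rE; rewrite (split i) tE dropE pE'.
    set A := pi1 ^+ (totient M - i.+1) => H.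
    apply: (mulIf (_ : pi1 * pi1 ^+ i != 0)); first by rewrite mulf_neq0 ?expf_neq0 ?pi1_neq0.
    transitivity ((r`_i)%:~R * pi1 ^+ i); first by rewrite mulrA divfK ?pi1_neq0.
    transitivity (eps * (A * (pi1 * pi1 ^+ i)) * x - eps * (A * (pi1 * pi1 ^+ i)) * t
      - ev d' * (pi1 * pi1 ^+ i)); last by ring.
    by rewrite H; ring.
  apply: integral_sub; last exact: Zzeta_integral.
  apply: integral_mul; last by apply: integral_sub => //; apply: Zzeta_integral.
  by apply: Zzeta_integral; apply: Zzeta_mul => //; apply: Zzeta_exp.
have [t tZ tE] := take_div (totient M) p_dvd.
have -> : x = t + eps' * ev (drop_poly (totient M) r).
  apply: (mulfI p0); rewrite rE (split (totient M)) tE pi1E; ring.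
by apply: Zzeta_add => //; apply: Zzeta_mul.
Qed.

Lemma Zzeta_of_Mmul (x : K) : integral x -> in_Zzeta (M%:R * x) -> in_Zzeta x.
Proof.
rewrite ME; elim: e.+1 => [|k IHk] x_int; first by rewrite mul1r.
rewrite expnS natrM -mulrA => /Zzeta_of_pmul H; apply: IHk => //; apply: H.
by apply: integral_mul => //; apply: integral_nat.
Qed.

(** * Relative traces to Q(xi) and Q(zeta) *)

Lemma rot_xi_inertia (s : unit_exp M) : rot (s, unit_exp1 N_gt0) xi = xi.
Proof. by rewrite rot_xi uval1 (prim_expr_mod xi_prim). Qed.

Lemma rot_zeta_inertia (s : unit_exp M) : rot (s, unit_exp1 N_gt0) zeta = zeta ^+ uval s.
Proof. exact: rot_zeta. Qed.

Lemma inertia_trace_is_zmod_morphism : zmod_morphism inertia_trace.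
Proof. by move=> x y; rewrite /inertia_trace -sumrB; apply: eq_bigr => i _; rewrite rmorphB. Qed.

HB.instance Definition _ :=
  GRing.isZmodMorphism.Build K K inertia_trace inertia_trace_is_zmod_morphism.

Lemma inertia_trace_xi (x : K) (j : nat) :
  inertia_trace (x * xi ^+ j) = inertia_trace x * xi ^+ j.
Proof. by rewrite mulr_suml; apply: eq_bigr => s _; rewrite rmorphM rmorphXn rot_xi_inertia. Qed.

Lemma inertia_trace_int_mul (m : int) (x : K) :
  inertia_trace (m%:~R * x) = m%:~R * inertia_trace x.
Proof. by rewrite mulr_sumr; apply: eq_bigr => s _; rewrite rmorphM rmorph_int. Qed.

Lemma inertia_trace_integral (x : K) : integral x -> integral (inertia_trace x).
Proof. by move=> x_int; apply: integral_sum => s _; apply: rot_integral. Qed.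

Lemma inertia_trace_zeta (k : nat) :
  inertia_trace (zeta ^+ k) =
  (if (M %| k)%N then M%:R else 0) - (if (g %| k)%N then g%:R else 0).
Proof.
by rewrite -ramanujan_sum; apply: eq_bigr => s _; rewrite rmorphXn rot_zeta_inertia exprM.
Qed.

(** In the Ramanujan sums of zeta^k and zeta^(k+g) the terms in g agree, because g divides k exactly
    when it divides k + g. The factor 1 - omega cancels them and leaves multiples of M. *)
Lemma inertia_trace_Zzeta (y : K) : in_Zzeta y ->
  exists m : int, inertia_trace (y * (1 - zeta ^+ g)) = M%:R * m%:~R.
Proof.
case=> q ->; exists (\sum_(k < size q) q`_k * ((M %| k)%N%:Z - (M %| k + g)%N%:Z)).
rewrite (horner_coef_wide _ (size_poly _ _)) mulr_suml raddf_sum rmorph_sum mulr_sumr /=.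
apply: eq_bigr => k _; rewrite coef_map /= -mulrA inertia_trace_int_mul mulrBr mulr1 -exprD.
rewrite raddfB /= !inertia_trace_zeta (dvdn_addl _ (dvdnn g)) intrM intrB.
by case: (M %| k)%N (M %| k + g)%N (g %| k)%N => [] [] [] /=; rewrite ?mulr0z ?mulr1z; ring.
Qed.

(** The trace from [K] to Q(zeta), complementary to [inertia_trace]. *)
Definition decomposition_trace (x : K) : K := \sum_(t : unit_exp N) rot (unit_exp1 M_gt0, t) x.

Lemma gtrace_tower (x : K) : inertia_trace (decomposition_trace x) = gtrace x.
Proof.
rewrite /inertia_trace /gtrace.
under eq_bigr => s _ do rewrite rmorph_sum.
rewrite pair_bigA /=; apply: eq_bigr => -[s t] _ /=.
apply: (@eq_rot _ (rot (s, unit_exp1 N_gt0) \o rot (unit_exp1 M_gt0, t)) (rot (s, t))) => /=.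
rewrite !rot_gen /conjugate /= rmorphM !rmorphXn rot_zeta_inertia rot_xi_inertia.
by rewrite uval1 exprAC (prim_expr_mod zeta_prim) expr1.
Qed.

Lemma decomposition_trace_zeta (x : K) (i : nat) :
  decomposition_trace x * zeta ^- i = decomposition_trace (x * zeta ^- i).
Proof.
rewrite mulr_suml; apply: eq_bigr => t _.
by rewrite rmorphM fmorphV rmorphXn rot_zeta uval1 (prim_expr_mod zeta_prim).
Qed.

Lemma integral_unity (x : K) (k n : nat) : (0 < n)%N -> x ^+ n = 1 -> integral (x ^- k).
Proof.
move=> n_gt0 xn1; exists ('X^n - 1); first by rewrite monicXnsubC.
rewrite rmorphB rmorph1 /= map_polyXn.
by rewrite /root !hornerE exprVn exprAC xn1 expr1n invr1 subrr.
Qed.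

Lemma inertia_trace_inversion (w : K) :
  \sum_(i < M) inertia_trace (w * zeta ^- i) * zeta ^+ i = M%:R * w.
Proof.
apply: (@aut_sum_inversion K (unit_exp M) (fun s => rot (s, unit_exp1 N_gt0))
  (unit_exp1 M_gt0) rot1 zeta M M_gt0 (prim_expr_order zeta_prim)).
move=> s; apply/eqP/eqP => [|->]; last exact: rot1.
move=> sz; suff: (s, unit_exp1 N_gt0) = gamma1 by case.
by apply: rot_inj; rewrite rot1 rmorphM sz rot_xi_inertia.
Qed.

(** Inversion writes M times this trace as a combination of powers of [zeta] whose coefficients are
    absolute traces of integral elements, hence integers; [Zzeta_of_Mmul] then removes M. *)
Lemma decomposition_trace_Zzeta (y : K) : integral y -> in_Zzeta (decomposition_trace y).
Proof.
move=> y_int; apply: Zzeta_of_Mmul.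
  by apply: integral_sum => t _; apply: rot_integral.
rewrite -inertia_trace_inversion; apply: Zzeta_sum => i _.
apply: Zzeta_mul; last exact/Zzeta_exp/Zzeta_zeta.
rewrite decomposition_trace_zeta gtrace_tower.
have [|m ->] := @gtrace_int (y * zeta ^- i); last exact: Zzeta_int.
by apply: integral_mul => //; apply: integral_unity M_gt0 (prim_expr_order zeta_prim).
Qed.

(* Multiplying by N is harmless because M and N are coprime; N y is a combination
   of powers of xi with coefficients in Z[zeta]. *)
Lemma inertia_trace_div (y : K) : integral y ->
  integral (inertia_trace (y * (1 - zeta ^+ g)) / M%:R).
Proof.
move=> y_int; set T := inertia_trace _.
have M0 : M%:R != 0 :> K by rewrite fieldExt_natr_eq0 -lt0n.
have omega_int : integral (1 - zeta ^+ g).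
  by apply: integral_sub; [apply: integral1|apply/integral_exp/integral_zeta].
have T_int : integral T by apply/inertia_trace_integral/integral_mul.
have NT_int : integral (N%:R * T / M%:R).
  have NyE := @aut_sum_inversion K (unit_exp N) (fun t => rot (unit_exp1 M_gt0, t))
    (unit_exp1 N_gt0) rot1 xi N N_gt0 (prim_expr_order xi_prim) _ y.
  have -> : N%:R * T = inertia_trace (N%:R * y * (1 - zeta ^+ g)).
    by rewrite -mulrA; exact: esym (inertia_trace_int_mul N _).
  rewrite -NyE; last first.
    move=> t; apply/eqP/eqP => [|->]; last exact: rot1.
    move=> tx; suff: (unit_exp1 M_gt0, t) = gamma1 by case.
    by apply: rot_inj; rewrite rot1 rmorphM tx rot_zeta uval1 (prim_expr_mod zeta_prim).
  rewrite [X in inertia_trace X]mulr_suml raddf_sum mulr_suml; apply: integral_sum => j _ /=.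
  rewrite mulrAC inertia_trace_xi -/(decomposition_trace _).
  have [|m ->] := @inertia_trace_Zzeta (decomposition_trace (y * xi ^- j)).
    apply: decomposition_trace_Zzeta; apply: integral_mul => //.
    exact: integral_unity N_gt0 (prim_expr_order xi_prim).
  have -> : M%:R * m%:~R * xi ^+ j / M%:R = m%:~R * xi ^+ j by field.
  apply: integral_mul; first exact: integral_int.
  rewrite -[xi ^+ j]invrK -exprVn; apply: (@integral_unity _ _ N); rewrite // exprVn.
  by rewrite (prim_expr_order xi_prim) invr1.
(* With a N = 1 + b M, T/M equals a (N T/M) - b T. *)
have /(coprimeP _ N_gt0)[[a b] /= ab] : coprime N M by rewrite coprime_sym.
have -> : T / M%:R = a%:R * (N%:R * T / M%:R) - b%:R * T.
  have : a%:R * N%:R = 1 + b%:R * M%:R :> K.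
    by rewrite -!natrM -(natrD _ 1); congr (_%:R); lia.
  move=> abK; rewrite !mulrA abK; field; exact: M0.
by apply: integral_sub; apply: integral_mul => //; apply: integral_nat.
Qed.

Lemma nform_mul_nat (n : nat) (x : K) : nform (n%:R * x) = n%:R ^+ 2 * nform x.
Proof.
rewrite /nform mulr_sumr; apply: eq_bigr => i _.
rewrite !rmorphM !rmorph_nat nsqM; congr (_ * _).
by rewrite /nsq -(rmorph_nat (real_complex R)) /= expr0n addr0.
Qed.

Lemma sum_omega : \sum_(k < p) (zeta ^+ g) ^+ k = 0.
Proof.
rewrite sum_expr_unity; last by rewrite -exprM -MgE (prim_expr_order zeta_prim).
by rewrite -(prim_order_dvd zeta_prim) gtnNdvd // MgE -{1}[g]muln1 ltn_pmul2l ?prime_gt1.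
Qed.

(** * Units are far from pi *)

Section Unit.

Variables (u v : K).
Hypotheses (u_int : integral u) (v_int : integral v) (uv1 : u * v = 1).

(** By [inertia_trace_inversion], w is the sum of the [tau i] times zeta^i. The element [b] is the
    step of [tau] by [g], shown below to be independent of the starting index modulo integers. *)
Let w : K := u / pi1.
Let tau (i : nat) : K := inertia_trace (w * zeta ^- i) / M%:R.
Let b : K := tau g - tau 0.

Let M_neq0 : M%:R != 0 :> K.
Proof. by rewrite fieldExt_natr_eq0 -lt0n. Qed.

(** A step in i multiplies by 1 - zeta, which cancels the denominator of [w]; a step by g supplies
    the factor 1 - omega that [inertia_trace_div] requires. *)
Let tau_second_difference (i : nat) :
  integral ((tau (i.+1 + g) - tau i.+1) - (tau (i + g) - tau i)).
Proof.
have -> : (tau (i.+1 + g) - tau i.+1) - (tau (i + g) - tau i) =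
    inertia_trace (u * zeta ^- (i.+1 + g) * (1 - zeta ^+ g)) / M%:R.
  rewrite /tau -!mulrBl -!raddfB /=; congr (inertia_trace _ / _).
  rewrite /w !exprD !exprS /pi1.
  have A0 : zeta ^+ i != 0 by rewrite expf_neq0 ?zeta_neq0.
  have B0 : zeta ^+ g != 0 by rewrite expf_neq0 ?zeta_neq0.
  have := pi1_neq0; rewrite /pi1; have := zeta_neq0.
  move: (zeta ^+ i) (zeta ^+ g) A0 B0 => A B A0 B0 z0 pi0.
  by field; rewrite A0 B0 z0 pi0.
apply: inertia_trace_div; apply: integral_mul => //.
exact: integral_unity M_gt0 (prim_expr_order zeta_prim).
Qed.

Let tau_step (i : nat) : integral (tau (i + g) - tau i - b).
Proof.
elim: i => [|i IHi]; first by rewrite add0n subrr; apply: mxpoly.integral0.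
by have := integral_add (tau_second_difference i) IHi; congr integralOver; ring.
Qed.

(** Otherwise [tau] would be constant modulo integers on classes modulo g, which makes [w] integral;
    so would be w v = 1/pi, and p would divide 1. *)
Let b_nonintegral : ~ integral b.
Proof.
move=> b_int.
have tau_diff r k : integral (tau (k * g + r) - tau r).
  elim: k => [|k IHk]; first by rewrite mul0n add0n subrr; apply: mxpoly.integral0.
  have := integral_add (integral_add (tau_step (k * g + r)) b_int) IHk.
  rewrite (_ : k * g + r + g = k.+1 * g + r)%N; last by rewrite mulSnr addnAC.
  by congr integralOver; ring.
have w_int : integral w.
  have -> : w = \sum_(k < p) \sum_(r < g) (tau (k * g + r) - tau r) * zeta ^+ (k * g + r).
    apply: (mulfI M_neq0); rewrite -inertia_trace_inversion.
    have tauE i : inertia_trace (w * zeta ^- i) = M%:R * tau i by rewrite /tau [RHS]mulrC divfK.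
    under eq_bigr => i _ do rewrite tauE -mulrA.
    rewrite -mulr_sumr; congr (_ * _).
    rewrite [in LHS]MgE [in LHS](mulnC g) (big_ord_mul _ _ _ (fun i => tau i * zeta ^+ i)).
    (* The part of [tau] that depends only on r contributes nothing, as the powers of omega sum to
       zero; only the integral differences remain. *)
    have tau_sum : \sum_(k < p) \sum_(r < g) tau r * zeta ^+ (k * g + r) = 0.
      rewrite exchange_big big1 // => r _.
      transitivity (tau r * zeta ^+ r * \sum_(k < p) (zeta ^+ g) ^+ k).
        by rewrite mulr_sumr; apply: eq_bigr => k _; rewrite exprD [(k * g)%N]mulnC exprM; ring.
      by rewrite sum_omega mulr0.
    transitivity (\sum_(k < p) \sum_(r < g) tau (k * g + r) * zeta ^+ (k * g + r) -
      \sum_(k < p) \sum_(r < g) tau r * zeta ^+ (k * g + r)); first by rewrite tau_sum subr0.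
    rewrite -sumrB; apply: eq_bigr => k _.
    by rewrite -sumrB; apply: eq_bigr => r _; rewrite mulrBl.
  apply: integral_sum => k _; apply: integral_sum => r _; apply: integral_mul => //.
  exact/integral_exp/integral_zeta.
have : integral (1%:~R / pi1).
  have := integral_mul w_int v_int; congr integralOver.
  by rewrite /w mulrAC uv1.
by move/int_div_pi1; rewrite dvdzE /= dvdn1 gtn_eqF ?prime_gt1.
Qed.

(** [progression_bound] is applied to each of the g classes modulo g and the results are added. By
    Parseval the sum of the nform(tau i) is phi(M)/M times nform(w), hence at most nform(w). *)
Lemma unit_nform_bound : M%:R * #|gamma|%:R <= 98 * nform (u / (1 - zeta)).
Proof.
have tau_per i : tau (i + M) = tau i.
  by rewrite /tau exprD (prim_expr_order zeta_prim) mulr1.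
have tau_sum : M%:R * #|gamma|%:R <= 98 * \sum_(i < M) nform (tau i).
  rewrite [in leRHS]MgE [in leRHS](mulnC g) (big_ord_mul _ _ _ (fun i => nform (tau i))).
  rewrite exchange_big mulr_sumr [in leLHS]MgE natrM -mulrA.
  rewrite -[X in X%:R * _]card_ord mulr_natl -sumr_const; apply: ler_sum => r _.
  apply: (@progression_bound p (fun k => tau (k * g + r)%N) b) => // k.
    by rewrite mulnDl [(p * g)%N]mulnC -MgE addnAC tau_per.
  by rewrite mulSnr addnAC; apply: tau_step.
apply: le_trans tau_sum _; rewrite ler_pM2l //.
have MR_gt0 : 0 < M%:R :> R by rewrite ltr0n.
have traceE i : nform (inertia_trace (w * zeta ^- i)) = M%:R ^+ 2 * nform (tau i).
  by rewrite -nform_mul_nat /tau [X in _ = nform X]mulrC divfK.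
have := inertia_parseval w; under eq_bigr => i _ do rewrite traceE.
rewrite -mulr_sumr expr2 natrM -!mulrA => /(mulfI (lt0r_neq0 MR_gt0)) parseval.
rewrite -(ler_pM2l MR_gt0) parseval ler_wpM2r ?nform_ge0 // ler_nat.
rewrite totient_count_coprime (leq_trans (leq_sum _ (fun i _ => leq_b1 _))) //.
by rewrite sum_nat_const_nat muln1 subn0.
Qed.

End Unit.

(** * Lower bound for the discrepancy in terms of [M] *)

Lemma embedding_star (s : {rmorphism K -> R[i]}) (x : K) : s (star x) = (s x)^*%C.
Proof.
have MN_gt0 : (0 < M * N)%N by rewrite muln_gt0 M_gt0.
have zMN : (zeta * xi) ^+ (M * N) = 1 by have [z_prim _ _] := z_gen; apply: prim_expr_order.
(* Total positivity concerns all embeddings, not only [incl]; the generator is a root of unity, of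
   absolute value 1 under each of them. *)
apply: (@eq_rot _ (s \o star) (@conjc R \o s)) => /=.
rewrite (star_unity MN_gt0 zMN) fmorphV.
have sz0 : s (zeta * xi) != 0.
  by rewrite fmorph_eq0 mulf_neq0 ?zeta_neq0 // (prim_root_eq0 xi_prim) -lt0n.
apply: (mulfI sz0); rewrite divff // mul_conj (nsq_unity MN_gt0) //.
by rewrite -rmorphXn zMN rmorph1.
Qed.

Lemma nform1 : nform 1 = #|gamma|%:R.
Proof.
rewrite /nform; under eq_bigr => i _ do rewrite !rmorph1 nsq1.
by rewrite sumr_const.
Qed.

(** Every conjugate of 1 - zeta has absolute value at most 2. *)
Lemma nform_le_div (x : K) : nform x <= 4 * nform (x / pi1).
Proof.
rewrite /nform mulr_sumr; apply: ler_sum => i _.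
rewrite -{1}(divfK pi1_neq0 x) !rmorphM nsqM mulrC ler_wpM2r ?nsq_ge0 //.
have := @nsq_unity (incl (rot i zeta)) M M_gt0.
rewrite -!rmorphXn (prim_expr_order zeta_prim) !rmorph1 => /(_ erefl).
rewrite /pi1 !rmorphB !rmorph1 /nsq; case: (incl _) => [c s] /= cs1.
by have := sqr_ge0 s; have := sqr_ge0 (c + 1); lra.
Qed.

Local Open Scope classical_set_scope.

Lemma discrepancy_ge : ((M%:R / 98)%:E <= reduction_discrepancy R star)%E.
Proof.
pose a : K := (pi1 * star pi1)^-1.
have d_gt0 : 0 < #|gamma|%:R :> R by rewrite ltr0n; apply/card_gt0P; exists gamma1.
have star_pi1 : star pi1 != 0 by rewrite fmorph_eq0 pi1_neq0.
have traceE x : trace_form R star a x = nform (x / pi1).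
  rewrite /trace_form -field_trace_nform fmorph_div; congr (ratr (field_trace _)).
  by rewrite /a invfM; ring.
have a_pos : totally_positive R a.
  move=> s; rewrite /a fmorphV rmorphM embedding_star mul_conj invr_gt0 ltcR.
  rewrite lt_neqAle nsq_ge0 andbT eq_sym; apply/eqP => s0.
  have /eqP := mul_conj (s pi1); rewrite s0 -embedding_star -rmorphM fmorph_eq0.
  by rewrite mulf_eq0 (negbTE pi1_neq0) (negbTE star_pi1).
(* This bound serves to make [mu] positive: a quotient by zero would be zero. *)
have mu_ge : #|gamma|%:R / 4 <= mu R star a.
  apply: lb_le_inf.
    by exists (trace_form R star a 1), 1 => //; split; [apply: integral1|apply/eqP/oner_neq0].
  move=> _ [x [x_int /eqP x0] <-]; rewrite traceE ler_pdivrMr // mulrC.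
  exact: le_trans (nform_integral_ge x_int x0) (nform_le_div x).
(* The witness is x = pi, at which the form takes the value nform(1) = d. *)
have mu_le : mu R star a <= #|gamma|%:R.
  rewrite -nform1 -(divff pi1_neq0) -traceE; apply: ge_inf.
    by exists 0 => _ [x _ <-]; rewrite traceE nform_ge0.
  exists pi1 => //; split; last exact/eqP/pi1_neq0.
  by apply: integral_sub; [apply: integral1|apply: integral_zeta].
have units_ge : M%:R * #|gamma|%:R / 98 <= mu_units R star a.
  apply: lb_le_inf.
    exists (trace_form R star a 1), 1 => //; split; first exact: integral1.
    by exists 1; [apply: integral1|rewrite mulr1].
  move=> _ [u [u_int [v v_int uv1]] <-]; rewrite traceE ler_pdivrMr // [leRHS]mulrC.
  exact: unit_nform_bound u_int v_int uv1.
have mu_gt0 : 0 < mu R star a by apply: lt_le_trans mu_ge; rewrite divr_gt0.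
apply: le_trans (_ : ((mu_units R star a / mu R star a)%:E <= _)%E); last first.
  by apply: ereal_sup_ubound; exists a.
rewrite lee_fin ler_pdivlMr //; apply: le_trans units_ge.
by rewrite mulrAC ler_wpM2r // ler_wpM2l.
Qed.

End PrimePower.

End NormForm.

End Rotations.

(** * Large prime power components and the limit *)

Lemma prime_power_part_gt (n B : nat) :
  (B`! < n)%N -> exists2 q, prime q & (B < q ^ logn q n)%N.
Proof.
move=> n_gt; have n_gt0 : (0 < n)%N by apply: leq_ltn_trans n_gt.
apply/not_exists2P => all_le.
(* If all prime power components of n are at most B, each divides B!, hence so does n, against B! <
   n. *)
suff /(dvdn_leq (fact_gt0 B)) : (n %| B`!)%N by rewrite leqNgt n_gt.
apply/dvdn_partP => // q; rewrite mem_primes => /and3P[q_prime _ _].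
have [//|] := all_le q; rewrite p_part => /negP; rewrite -leqNgt => le_B.
by rewrite dvdn_fact // expn_gt0 prime_gt0.
Qed.

(** The canonical generator is a power z^k, so a polynomial in it becomes one in [z] by substituting
    X^k. This is needed for a [z] that is a product of roots of coprime orders. *)
Lemma cyclotomic_field_generator (R : realType) (n : nat) (z : cyclotomic_field R n) :
  (0 < n)%N -> n.-primitive_root z -> cyclotomic_generator n z.
Proof.
move=> n_gt0 z_prim; split=> // [|x].
  by have := cyclotomic_poly_irr n; rewrite /cyclotomic_poly (maxn_idPr n_gt0).
have gen_prim : n.-primitive_root (cyclotomic_gen R n).
  by rewrite -(fmorph_primitive_root (cyclotomic_incl R n)) cyclotomic_incl_gen zeta_prim.
have [k genE] := prim_rootP z_prim (prim_expr_order gen_prim).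
have [q ->] := cyclotomic_field_horner x.
exists (q \Po 'X^k).
by rewrite map_comp_poly horner_comp map_polyXn hornerXn genE.
Qed.

Lemma delta_cyclotomic_ge (R : realType) (n q : nat) : (0 < n)%N -> prime q -> (q %| n)%N ->
  (((q ^ logn q n)%:R / 98)%:E <= delta_cyclotomic R n)%E.
Proof.
move=> n_gt0 q_prime q_dvd.
have gen_prim : n.-primitive_root (cyclotomic_gen R n).
  by rewrite -(fmorph_primitive_root (cyclotomic_incl R n)) cyclotomic_incl_gen zeta_prim.
(* M is the q-part of n and N its part prime to q; [zeta] and [xi] are the corresponding powers of
   the generator. *)
have Mn : (n`_q * n`_q^' = n)%N := partnC q n_gt0.
have zeta_prim := dvdn_prim_root gen_prim (dvdn_part q n).
have xi_prim := dvdn_prim_root gen_prim (dvdn_part q^' n).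
have cop : coprime n`_q n`_q^' := coprime_partC q n n.
have z_prim := prim_root_mul cop zeta_prim xi_prim; rewrite [X in X.-primitive_root]Mn in z_prim.
have z_gen := cyclotomic_field_generator n_gt0 z_prim.
rewrite -[X in cyclotomic_generator X _]Mn in z_gen.
have ME : (n`_q)%N = (q ^ (logn q n).-1.+1)%N.
  by rewrite p_part prednK // logn_gt0 mem_primes q_prime n_gt0.
have := discrepancy_ge zeta_prim xi_prim cop z_gen (@cyclotomic_conjE R n) q_prime ME.
by rewrite p_part.
Qed.

Local Open Scope classical_set_scope.
Local Open Scope ereal_scope.

Theorem corollary3p2 (R : realType) :
  delta_cyclotomic R N @[N --> \oo] --> +oo.
Proof.
apply/cvgeyPge => A.
(* B exceeds |98 A|. The successor makes it positive, so that a q with B < q^(logn q n) must divide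
   n. *)
pose B := (Num.bound `|98 * A|%R).+1.
exists (B`!).+1 => // n /= n_gt.
have n_gt0 : (0 < n)%N by apply: leq_ltn_trans n_gt.
have [q q_prime q_big] := prime_power_part_gt n_gt.
have [q_dvd|q_ndvd] := boolP (q %| n)%N; last first.
  by move: q_big; rewrite lognE (negbTE q_ndvd) !andbF.
apply: le_trans (delta_cyclotomic_ge R n_gt0 q_prime q_dvd).
rewrite lee_fin ler_pdivlMr // mulrC (le_trans (ler_norm _)) //.
rewrite (le_trans (ltW (archi_boundP (normr_ge0 _)))) // ler_nat.
by apply/ltnW/ltnW.
Qed.
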